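(* Let $n \geq 1$ be an integer. For every $T_n \in \mathcal{T}_n^c$ we have $$\int_{\partial D} \log^+|T_n'(z)/n|\,|dz| \leq \int_{\partial D} \log^+|T_n(z)|\,|dz| .$$
   Context: $\mathcal{T}_n^c$ denotes the collection of all trigonometric polynomials $T_n$ of the form $T_n(z) = \sum_{j=-n}^{n} a_j z^j$, with $a_j \in \mathbb{C}$ and $z \in \mathbb{C}\setminus\{0\}$. $T_n'$ denotes the derivative of $T_n$ with respect to the complex variable $z$. $D$ is the open unit disk and $\partial D$ is the unit circle of the complex plane. The notation $\log^+|a| := \max\{\log|a|, 0\}$ is used for $a \in \mathbb{C}$, with $\log 0 = -\infty$, so $\log^+ 0 = 0$. The integral with respect to $|dz|$ is integration with respect to arc length: $\int_{\partial D} f(z)\,|dz| = \int_0^{2\pi} f(e^{it})\,dt$. *)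

(* Defs.v *)
From HB Require Import structures.
From mathcomp Require Import all_boot all_order all_algebra.
From mathcomp Require Import all_classical all_reals all_analysis.
From mathcomp Require Import complex.

Set Implicit Arguments.
Unset Strict Implicit.
Unset Printing Implicit Defensive.

Import Order.TTheory GRing.Theory Num.Theory.
Import numFieldNormedType.Exports.

Local Open Scope classical_set_scope.
Local Open Scope ring_scope.
Local Open Scope complex_scope.

(* The terms a_j z^j, -n <= j <= n, are listed by k = j + n; z ^ j is the
   integer power. Nothing is required of T at 0, where negative powers are not
   defined. *)
Definition trig_poly (R : realType) (n : nat) (T : R[i] -> R[i]) : Prop :=
  exists a : int -> R[i], forall z : R[i], z != 0 ->
    T z = \sum_(k < (2 * n).+1) a (k%:Z - n%:Z) * z ^ (k%:Z - n%:Z).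

(* R[i]^o is R[i] as a normed space over itself, so that derive1 is the
   limit of difference quotients over complex increments. *)
Definition cderiv (R : realType) (f : R[i] -> R[i]) (z : R[i]) : R[i] :=
  @derive1 R[i] R[i]^o f z.

(* lne 0 = -oo *)
Definition log_plus (R : realType) (a : R[i]) : \bar R :=
  maxe (lne (ComplexField.Normc.normc a)%:E) 0%E.

Definition circle_integral (R : realType) (f : R[i] -> \bar R) : \bar R :=
  (\int[lebesgue_measure]_(t in `[0%R, (2 * pi)%R]) f (cos t +i* sin t)%C)%E.

(* Main.v *)
Require Import Defs.
From mathcomp Require Import all_boot all_order all_algebra.
From mathcomp Require Import all_classical all_reals all_analysis.
From mathcomp Require Import complex.
From mathcomp Require Import ring lra.

(** Write [T z = p.[z] / z ^+ n] with [p] of degree at most [2 n].  On the unit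
    circle [T] has the modulus of [p], and the derivative of [T] that of
    [D p = z p' - n p], called [centered_deriv n p] below.

    The heart of the proof is an inequality for logarithms instead of log+,
    in the spirit of Mahler's inequality for the derivative.  Let
    [p1], [p2] have degree at most [2 n] and no common zero on the circle.  By
    the Fejer-Riesz theorem ([fejer_riesz]) there is a polynomial [q] of degree
    [2 n], with all its roots in the open disc, such that
    [|q|^2 = |p1|^2 + |p2|^2] on the circle.  By Bernstein's comparison
    principle ([centered_deriv_dominated2]), which rests on the maximum
    principle and on the fact that [D] keeps the roots of such polynomials in
    the open disc ([centered_deriv_neq0]), one has
    [|D p1|^2 + |D p2|^2 <= |D q|^2] there.  For polynomials with all roots in
    the disc the mean of the logarithm of the modulus is, by Jensen's formula
    ([jensen_zeta]), that of the leading coefficient, and [D] multiplies the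
    leading coefficient of [q] by [n].  Therefore
    [mean (ln (|D p1|^2 + |D p2|^2)) <= 2 ln n + mean (ln (|p1|^2 + |p2|^2))].

    Apply this to [p1 = p - c z^(2n)] and [p2 = d z^(2n)] with [|c| = 1] and
    [d > 0]. As [D] multiplies [z^(2n)] by [n], it compares the means of
    [ln (|u - c|^2 + d^2)] for [u = D p / (n z^(2n))] and [u = p / z^(2n)].
    Averaging over [c] gives the theorem, since the average over the circle of
    [ln (|u - c|^2 + d^2)] tends to [2 log+ |u|] as [d] tends to 0
    ([prod_zeta_le], [prod_zeta_ge]).

    The number [d] also removes all logarithmic singularities.  So every mean,
    over the variable as well as over [c], can be taken over the roots of
    unity, where the inequalities become inequalities between finite products
    ([log_plus_zeta]); integrals occur only at the end, as limits of Riemann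
    sums of Lipschitz functions ([le_Rintegral_of_riemann_sums]). *)

Set Implicit Arguments.
Unset Strict Implicit.
Unset Printing Implicit Defensive.

Import Order.TTheory GRing.Theory Num.Theory.
Import numFieldNormedType.Exports.

Local Open Scope ring_scope.
Local Open Scope complex_scope.

Local Notation modulus := ComplexField.Normc.normc.
Local Notation "z ^*" := (conjc z) : ring_scope.

(** * The real-valued modulus *)

Section Modulus.
Variable R : rcfType.
Implicit Types z w : R[i].

Lemma modulusE z : `|z| = (modulus z)%:C. Proof. by []. Qed.

Lemma modulus_ge0 z : 0 <= modulus z.
Proof. by rewrite -ler0c -modulusE normr_ge0. Qed.

Lemma modulus_eq0 z : (modulus z == 0) = (z == 0).
Proof. by rewrite -(inj_eq (@complexI R)) -modulusE normr_eq0. Qed.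

Lemma modulus_gt0 z : (0 < modulus z) = (z != 0).
Proof. by rewrite lt_neqAle modulus_ge0 andbT eq_sym modulus_eq0. Qed.

Lemma modulusM z w : modulus (z * w) = modulus z * modulus w.
Proof. exact: ComplexField.Normc.normcM. Qed.

Lemma modulusV z : modulus z^-1 = (modulus z)^-1.
Proof. exact: ComplexField.Normc.normcV. Qed.

Lemma modulus1 : modulus (1 : R[i]) = 1.
Proof. exact: ComplexField.Normc.normc1. Qed.

Lemma modulus0 : modulus (0 : R[i]) = 0.
Proof. exact: ComplexField.Normc.normc0. Qed.

Lemma modulusD z w : modulus (z + w) <= modulus z + modulus w.
Proof. exact: le_normcD. Qed.

Lemma modulusN z : modulus (- z) = modulus z.
Proof. exact: normcN. Qed.

Lemma modulusB z w : modulus (z - w) <= modulus z + modulus w.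
Proof. by rewrite -(modulusN w) modulusD. Qed.

Lemma modulusBC z w : modulus (z - w) = modulus (w - z).
Proof. by rewrite -modulusN opprB. Qed.

Lemma modulusX z k : modulus (z ^+ k) = modulus z ^+ k.
Proof. by apply: complexI; rewrite rmorphXn /= -!modulusE normrX. Qed.

Lemma modulus_prod I (r : seq I) (P : pred I) (F : I -> R[i]) :
  modulus (\prod_(i <- r | P i) F i) = \prod_(i <- r | P i) modulus (F i).
Proof. by apply: complexI; rewrite rmorph_prod /= -!modulusE normr_prod. Qed.

Lemma modulus_sum I (r : seq I) (P : pred I) (F : I -> R[i]) :
  modulus (\sum_(i <- r | P i) F i) <= \sum_(i <- r | P i) modulus (F i).
Proof. by rewrite -lecR rmorph_sum /= -!modulusE ler_norm_sum. Qed.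

Lemma modulus_conj z : modulus z^* = modulus z.
Proof. by apply: complexI; rewrite -!modulusE normcJ. Qed.

Lemma modulusR (x : R) : modulus x%:C = `|x|.
Proof. by rewrite /= expr0n addr0 sqrtr_sqr. Qed.

Lemma modulus_nat n : modulus (n%:R : R[i]) = n%:R.
Proof. by rewrite -(rmorph_nat (real_complex R)) modulusR ger0_norm. Qed.

Lemma modulus_sqr z : modulus z ^+ 2 = complex.Re z ^+ 2 + complex.Im z ^+ 2.
Proof.
by case: z => x y /=; rewrite sqr_sqrtr // addr_ge0 // sqr_ge0.
Qed.

Lemma mulc_conj z : z * z^* = (modulus z ^+ 2)%:C.
Proof. by rewrite -sqr_normc modulusE rmorphXn. Qed.

Lemma conjcM z w : (z * w)^* = z^* * w^*.
Proof. exact: rmorphM. Qed.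

Lemma conjcXn z k : (z ^+ k)^* = z^* ^+ k.
Proof. exact: rmorphXn. Qed.

Lemma conjV_circle z : modulus z = 1 -> z^* = z^-1.
Proof.
move=> z1; have z0 : z != 0 by rewrite -modulus_eq0 z1 oner_eq0.
by apply: (mulfI z0); rewrite mulc_conj z1 expr1n divff.
Qed.

Lemma circle_neq0 z : modulus z = 1 -> z != 0.
Proof. by move=> z1; rewrite -modulus_eq0 z1 oner_eq0. Qed.

End Modulus.
(** * Means over roots of unity *)

Section RootsOfUnity.
Variable R : realType.

(** The root of unity with the smallest positive argument, so that its powers
    are also the nodes of the uniform Riemann sums on [[0, 2 pi]]. *)
Definition zeta (N : nat) : R[i] := cos (2 * pi / N%:R) +i* sin (2 * pi / N%:R).

Lemma expi_exp (t : R) k :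
  (cos t +i* sin t) ^+ k = (cos (k%:R * t) +i* sin (k%:R * t) : R[i]).
Proof.
elim: k => [|k IH]; first by rewrite expr0 mul0r cos0 sin0.
rewrite exprS IH -[k.+1]addn1 natrD mulrDl mul1r cosD sinD.
by apply/eqP; rewrite eq_complex /=; apply/andP; split; apply/eqP; ring.
Qed.

Lemma expi_circle (t : R) : modulus (cos t +i* sin t) = 1.
Proof. by rewrite /= cos2Dsin2 sqrtr1. Qed.

Lemma zeta_exp N k :
  zeta N ^+ k = cos (k%:R * (2 * pi / N%:R)) +i* sin (k%:R * (2 * pi / N%:R)).
Proof. exact: expi_exp. Qed.

Lemma zeta_circle N k : modulus (zeta N ^+ k) = 1.
Proof. by rewrite zeta_exp expi_circle. Qed.

Lemma zeta_prim N : (0 < N)%N -> N.-primitive_root (zeta N).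
Proof.
move=> N0; have N0' : (N%:R : R) != 0 by rewrite pnatr_eq0 -lt0n.
have zN : zeta N ^+ N = 1.
  rewrite zeta_exp mulrCA divff // mulr1 mulr_natl.
  by rewrite cos2pi -[pi *+ 2]add0r sinD2pi sin0.
have [m pm mN] := prim_order_exists N0 zN.
suff E : m = N by move: pm; rewrite E.
apply/eqP; move: (dvdn_leq N0 mN); rewrite leq_eqVlt => /orP[/eqP->//|mltN].
have m0 : (0 < m)%N by exact: prim_order_gt0 pm.
have := prim_expr_order pm; rewrite zeta_exp => -[+ _].
set x : R := _ * _; pose y := x / 2.
have -> : x = y + y by rewrite -splitr.
have Pi := pi_gt0 R.
have hx : x = 2 * pi * (m%:R / N%:R) by rewrite /x; field.
have q0 : 0 < m%:R / N%:R :> R by rewrite divr_gt0 ?ltr0n.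
have q1 : m%:R / N%:R < 1 :> R by rewrite ltr_pdivrMr ?ltr0n // mul1r ltr_nat.
have sy : 0 < sin y.
  have -> : y = pi * (m%:R / N%:R) by rewrite /y hx; field.
  by apply: sin_gt0_pi; rewrite mulr_gt0 //= gtr_pMr.
have := exprn_gt0 2 sy; have := cos2Dsin2 y; rewrite cosD -!expr2; lra.
Qed.

Lemma prod_sub_zeta N (x : R[i]) : (0 < N)%N ->
  \prod_(k < N) (x - zeta N ^+ k) = x ^+ N - 1.
Proof.
move=> N0; have E := factor_Xn_sub_1 (zeta_prim N0).
have <- : ('X^N - 1).[x] = x ^+ N - 1 by rewrite hornerD hornerN hornerC hornerXn.
rewrite -E big_mkord horner_prod.
by apply: eq_bigr => k _; rewrite hornerXsubC.
Qed.

Lemma sum_zeta N j : (0 < N)%N -> (0 < j < N)%N -> \sum_(k < N) zeta N ^+ k ^+ j = 0.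
Proof.
move=> N0 /andP[j0 jN]; have pz := zeta_prim N0.
have zj : zeta N ^+ j - 1 != 0.
  by rewrite subr_eq0 -(prim_order_dvd pz) gtnNdvd.
apply: (mulfI zj); rewrite mulr0.
under eq_bigr do rewrite exprAC.
by rewrite -subrX1 exprAC (prim_expr_order pz) expr1n subrr.
Qed.

(** The discrete mean value property: the sum kills every power [z ^+ j] with
    [0 < j < N]. *)
Lemma mean_zeta N (p : {poly R[i]}) : (0 < N)%N -> (size p <= N)%N ->
  \sum_(k < N) p.[zeta N ^+ k] = N%:R * p.[0].
Proof.
case: N => // N _ sp.
rewrite (eq_bigr (fun k : 'I_N.+1 => \sum_(j < N.+1) p`_j * (zeta N.+1 ^+ k) ^+ j));
  last by move=> k _; exact: horner_coef_wide.
rewrite exchange_big big_ord_recl /= [X in _ + X]big1 => [|j _].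
  rewrite addr0 horner_coef0; under eq_bigr do rewrite expr0 mulr1.
  by rewrite sumr_const card_ord mulr_natl.
by rewrite -mulr_sumr sum_zeta ?mulr0 //= /bump /= ltnS ltn_ord.
Qed.

Lemma horner0_le_circle (p : {poly R[i]}) (M : R) :
  (forall z, modulus z = 1 -> modulus p.[z] <= M) -> modulus p.[0] <= M.
Proof.
move=> pM; pose N := (size p).+1.
have N0 : 0 < (N%:R : R) by rewrite ltr0n.
rewrite -(ler_pM2l N0).
have <- : modulus (N%:R * p.[0]) = N%:R * modulus p.[0].
  by rewrite modulusM modulus_nat.
rewrite -mean_zeta ?leqnSn //.
apply: (le_trans (modulus_sum _ _ _)).
apply: (@le_trans _ _ (\sum_(k < N) M)).
  by apply: ler_sum => k _; exact/pM/zeta_circle.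
by rewrite sumr_const card_ord mulr_natl.
Qed.

End RootsOfUnity.

(** * The maximum principle at the centre of the disc *)

Section MaximumPrinciple.
Variable R : realType.
Implicit Types (p q : {poly R[i]}) (z w : R[i]).

(** With [a = 1] and [a = -1] this controls, from above and from below, every
    product of factors [1 - r ^+ N] with [r] in the open disc. *)
Lemma cvg_prod_1Dexp (a : R) (s : seq R) : (forall x, x \in s -> `|x| < 1) ->
  (\prod_(x <- s) (1 + a * x ^+ N) @[N --> \oo] --> (1 : R))%classic.
Proof.
elim: s => [|x s IH] xs.
  by under eq_fun do rewrite big_nil; exact: cvg_cst.
under eq_fun do rewrite big_cons.
have hs y : y \in s -> `|y| < 1 by move=> ys; apply: xs; rewrite inE ys orbT.
have xN : (x ^+ N @[N --> \oo] --> (0 : R))%classic.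
  by apply: cvg_expr; apply: xs; rewrite mem_head.
have A : (1 + a * x ^+ N @[N --> \oo] --> (1 + a * 0 : R))%classic.
  by apply: cvgD; [exact: cvg_cst | apply: cvgM => //; exact: cvg_cst].
by have := cvgM A (IH hs); rewrite mulr0 addr0 mulr1; apply.
Qed.

(** The geometric series of the inverse of [1 - z / b], truncated: up to the
    factor [- b], an approximate inverse of [z - b] on the closed disc when
    [1 < modulus b]. *)
Definition geom_sum (N : nat) (b : R[i]) : {poly R[i]} :=
  \sum_(j < N) (b^-1 *: 'X) ^+ j.

Lemma geom_sumE N b z : b != 0 ->
  (z - b) * (geom_sum N b).[z] = (0 - b) * (1 - (z / b) ^+ N).
Proof.
move=> b0; rewrite horner_sum.
under eq_bigr do rewrite horner_exp hornerZ hornerX mulrC.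
have -> : z - b = b * (z / b - 1) by rewrite mulrBr mulr1 mulrCA divff // mulr1.
by rewrite -mulrA -subrX1 sub0r mulNr -mulrN opprB.
Qed.

(** The mean value property applies to polynomials only, not to [p / q].
    Since the roots [b] of [q] lie outside the closed disc, the polynomial
    [G N], a product of truncated geometric series, is such that [q * G N] is
    the constant [q.[0]] times a product of factors [1 - (z / b) ^+ N], which
    are uniformly close to 1 on the circle and equal to 1 at the centre.  So
    the mean value property for [p * G N] gives the claim up to a factor that
    tends to 1. *)
Lemma max_principle0 p q :
  (forall z, modulus z <= 1 -> q.[z] != 0) ->
  (forall z, modulus z = 1 -> modulus p.[z] <= modulus q.[z]) ->
  modulus p.[0] <= modulus q.[0].
Proof.
move=> q0 pq.
have [s qE] := closed_field_poly_normal q.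
have qz z : q.[z] = lead_coef q * \prod_(b <- s) (z - b).
  rewrite {1}qE hornerZ horner_prod; congr (_ * _).
  by apply: eq_bigr => b _; rewrite hornerXsubC.
have sb b : b \in s -> 1 < modulus b.
  move=> bs; rewrite ltNge; apply/negP => /q0.
  by rewrite qz (big_rem b) //= subrr mul0r mulr0 eqxx.
pose G N := \prod_(b <- s) geom_sum N b.
have qG N z : q.[z] * (G N).[z] = q.[0] * \prod_(b <- s) (1 - (z / b) ^+ N).
  rewrite !qz horner_prod -!mulrA -!big_split /=; congr (_ * _).
  apply: eq_big_seq => b /sb b1; apply: geom_sumE.
  by rewrite -modulus_gt0 (lt_trans _ b1).
have q00 : q.[0] != 0 by apply: q0; rewrite modulus0.
have bound N : modulus p.[0] <=
    modulus q.[0] * \prod_(x <- [seq modulus b^-1 | b <- s]) (1 + 1 * x ^+ N.+1).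
  have G0 : (G N.+1).[0] = 1.
    apply: (mulfI q00); rewrite qG big1 // => b _.
    by rewrite mul0r expr0n /= subr0.
  rewrite -[p.[0]]mulr1 -G0 -hornerM; apply: horner0_le_circle => z z1.
  rewrite hornerM modulusM.
  apply: (le_trans (ler_wpM2r (modulus_ge0 _) (pq z z1))).
  rewrite -modulusM qG modulusM.
  rewrite ler_wpM2l ?modulus_ge0 // modulus_prod big_map.
  apply: ler_prod => b _; rewrite modulus_ge0 mul1r /=.
  apply: (le_trans (modulusB _ _)).
  by rewrite modulus1 modulusX modulusM z1 mul1r.
have lim : (modulus q.[0] * \prod_(x <- [seq modulus b^-1 | b <- s]) (1 + 1 * x ^+ N)
    @[N --> \oo] --> modulus q.[0])%classic.
  have P x : x \in [seq modulus b^-1 | b <- s] -> `|x| < 1.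
    move=> /mapP[b /sb b1 ->]; rewrite ger0_norm ?modulus_ge0 //.
    by rewrite modulusV invf_lt1 // (lt_trans _ b1).
  have := cvgM (cvg_cst (modulus q.[0])) (cvg_prod_1Dexp 1 P).
  by rewrite mulr1; apply.
apply: (cvgr_to_ge lim).
by exists 1%N => // -[//|N] _ /=; exact: bound.
Qed.

End MaximumPrinciple.

(** * Bernstein comparison for the centered derivative *)

Section Comparison.
Variable R : realType.
Implicit Types (p q U V : {poly R[i]}) (z w u v : R[i]).

(** The polynomial [V ^+ m * p (U / V)]: the pullback of [p], seen as a form
    of degree [m], by a rational map.  It turns statements about points outside
    the disc, infinity included, into statements about the centre. *)
Definition homog_subst m p U V : {poly R[i]} :=
  \sum_(k < m.+1) p`_k *: (U ^+ k * V ^+ (m - k)).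

Lemma homog_substE m p U V z : (size p <= m.+1)%N -> V.[z] != 0 ->
  (homog_subst m p U V).[z] = V.[z] ^+ m * p.[U.[z] / V.[z]].
Proof.
move=> sp v0; rewrite (horner_coef_wide _ sp) horner_sum mulr_sumr.
apply: eq_bigr => k _; rewrite hornerZ hornerM !horner_exp expr_div_n.
rewrite -[in V.[z] ^+ m](subnK (ltnSE (ltn_ord k))) exprD.
have vk : V.[z] ^+ k != 0 by rewrite expf_neq0.
by field.
Qed.

Lemma homog_subst_pole m p U V z : V.[z] = 0 -> (homog_subst m p U V).[z] = p`_m * U.[z] ^+ m.
Proof.
move=> v0; rewrite horner_sum big_ord_recr /= big1 => [|k _].
  by rewrite add0r hornerZ hornerM !horner_exp subnn mulr1.
by rewrite hornerZ hornerM !horner_exp v0 expr0n subn_eq0 leqNgt ltn_ord !mulr0.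
Qed.

(** [U / V] maps the closed disc to its exterior and the circle to itself, so
    the pullback of [q] does not vanish in the closed disc. *)
Lemma max_principle_homog m p q U V :
  (size p <= m.+1)%N -> (size q <= m.+1)%N -> q`_m != 0 ->
  (forall z, root q z -> modulus z < 1) ->
  (forall z, modulus z = 1 -> modulus p.[z] <= modulus q.[z]) ->
  (forall z, modulus z <= 1 -> U.[z] != 0) ->
  (forall z, modulus z <= 1 -> modulus V.[z] <= modulus U.[z]) ->
  (forall z, modulus z = 1 -> modulus V.[z] = modulus U.[z]) ->
  modulus (homog_subst m p U V).[0] <= modulus (homog_subst m q U V).[0].
Proof.
move=> sp sq qm rq pq U0 VU VU1; apply: max_principle0 => z z1.
  have [v0|v0] := eqVneq V.[z] 0.
    by rewrite homog_subst_pole // mulf_neq0 // expf_neq0 // U0.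
  rewrite homog_substE // mulf_neq0 ?expf_neq0 //.
  apply/negP => /rq; rewrite modulusM modulusV.
  by rewrite ltr_pdivrMr ?modulus_gt0 // mul1r ltNge VU.
have v0 : V.[z] != 0 by rewrite -modulus_eq0 VU1 // modulus_eq0 U0 // z1.
rewrite !homog_substE // !modulusM ler_wpM2l ?modulus_ge0 //.
apply: pq; rewrite modulusM modulusV VU1 //.
by rewrite divff // modulus_eq0 U0 // z1.
Qed.

Section Dominated.
Variables (m : nat) (p q : {poly R[i]}).
Hypotheses (sp : (size p <= m.+1)%N) (sq : (size q <= m.+1)%N) (qm : q`_m != 0).
Hypothesis rq : forall z, root q z -> modulus z < 1.
Hypothesis pq : forall z, modulus z = 1 -> modulus p.[z] <= modulus q.[z].

(** The maximum principle at infinity, through [z |-> 1 / z]. *)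
Lemma max_principle_coef : modulus p`_m <= modulus q`_m.
Proof.
have := @max_principle_homog m p q 1 'X sp sq qm rq pq.
rewrite !homog_subst_pole ?hornerX // !hornerC expr1n !mulr1; apply => z.
- by rewrite hornerC oner_neq0.
- by rewrite hornerC hornerX modulus1.
- by rewrite hornerC hornerX modulus1.
Qed.

(** The Moebius map [z |-> (z + w) / (1 + w^* z)] sends the disc to its
    exterior and 0 to [w]. *)
Lemma max_principle_exterior w : 1 <= modulus w -> modulus p.[w] <= modulus q.[w].
Proof.
rewrite le_eqVlt => /orP[/eqP w1|w1]; first exact: pq.
pose U : {poly R[i]} := 'X + w%:P; pose V : {poly R[i]} := 1 + w^* *: 'X.
have Ue z : U.[z] = z + w by rewrite hornerD hornerX hornerC.
have Ve z : V.[z] = 1 + w^* * z by rewrite hornerD hornerZ hornerX hornerC.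
have V0 : V.[0] = 1 by rewrite Ve mulr0 addr0.
(* this identity is why the map exchanges the disc and its exterior *)
have key z : modulus U.[z] ^+ 2 - modulus V.[z] ^+ 2 =
    (modulus w ^+ 2 - 1) * (1 - modulus z ^+ 2).
  rewrite Ue Ve !modulus_sqr; case: z w {w1 U V Ue Ve V0} => [a b] [c d] /=; ring.
have w2 : 0 < modulus w ^+ 2 - 1 by rewrite subr_gt0 exprn_egt1.
have := @max_principle_homog m p q U V sp sq qm rq pq.
rewrite !homog_substE ?V0 ?oner_neq0 // Ue add0r divr1 expr1n !mul1r; apply => z z1.
- rewrite Ue addr_eq0; apply/eqP => zw; move: z1.
  by rewrite zw modulusN leNgt w1.
- rewrite -(@ler_pXn2r _ 2) ?nnegrE ?modulus_ge0 // -subr_ge0 key.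
  by rewrite mulr_ge0 ?(ltW w2) // subr_ge0 exprn_ile1 ?modulus_ge0.
- apply/eqP; rewrite -(@eqrXn2 _ 2) ?modulus_ge0 // eq_sym -subr_eq0 key z1.
  by rewrite expr1n subrr mulr0.
Qed.

End Dominated.

(** On nonzero [z], this is [z ^+ n.+1] times the derivative of
    [z |-> p.[z] / z ^+ n]. *)
Definition centered_deriv n p : {poly R[i]} := 'X * p^`() - n%:R *: p.

Lemma centered_derivE n p z :
  (centered_deriv n p).[z] = z * p^`().[z] - n%:R * p.[z].
Proof. by rewrite hornerD hornerN hornerM hornerX hornerZ. Qed.

Lemma coef_centered_deriv n p k :
  (centered_deriv n p)`_k = (k%:R - n%:R) * p`_k.
Proof.
rewrite coefB coefXM coefZ mulrBl; congr (_ - _).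
by case: k => [|k] /=; rewrite ?mul0r // coef_deriv mulr_natl.
Qed.

Lemma centered_derivZ n c p : centered_deriv n (c *: p) = c *: centered_deriv n p.
Proof. by apply/polyP => k; rewrite !(coef_centered_deriv, coefZ); ring. Qed.

Lemma centered_derivB n p q :
  centered_deriv n (p - q) = centered_deriv n p - centered_deriv n q.
Proof. by apply/polyP => k; rewrite !(coef_centered_deriv, coefB); ring. Qed.

Lemma size_centered_deriv n p m : (size p <= m)%N ->
  (size (centered_deriv n p) <= m)%N.
Proof.
move=> /leq_sizeP sp; apply/leq_sizeP => j mj.
by rewrite coef_centered_deriv sp // mulr0.
Qed.

Lemma deriv_prod_XsubC (s : seq R[i]) z : (forall r, r \in s -> z != r) ->
  (\prod_(r <- s) ('X - r%:P))^`().[z] =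
  (\prod_(r <- s) ('X - r%:P)).[z] * \sum_(r <- s) (z - r)^-1.
Proof.
elim: s => [|r s IH] zs; first by rewrite !big_nil derivC horner0 mulr0.
have zr : z - r != 0 by rewrite subr_eq0 zs // mem_head.
rewrite !big_cons derivM !hornerE /= derivXsubC hornerC mul1r.
rewrite IH => [|x xs]; last by rewrite zs // inE xs orbT.
by field.
Qed.

(** [z / (z - r)] is the image of [z] under a map sending the exterior of the
    circle of radius [modulus r] to the half-plane right of [1 / 2]. *)
Lemma Re_div_sub z r : modulus r < 1 -> 1 <= modulus z ->
  1 / 2 < complex.Re (z / (z - r)).
Proof.
move=> r1 z1.
have zr : z - r != 0.
  by rewrite subr_eq0; apply/eqP => zr; move: z1; rewrite zr leNgt r1.
have : modulus r ^+ 2 < modulus z ^+ 2.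
  rewrite ltr_pXn2r // ?nnegrE ?modulus_ge0 //; exact: lt_le_trans r1 z1.
have : 0 < modulus (z - r) ^+ 2 by rewrite exprn_gt0 // modulus_gt0.
rewrite !modulus_sqr; case: z r {r1 z1 zr} => [a b] [c d] /= D0 rz.
set D := _ + _ in D0 *.
have -> : a * ((a - c) / D) - b * - ((b - d) / D) = (a * (a - c) + b * (b - d)) / D.
  by field; rewrite gt_eqF.
by rewrite ltr_pdivlMr // /D; lra.
Qed.

(** An argument of Gauss-Lucas type: [z q' / q] is the sum of [z / (z - r)]
    over the [2 n] roots [r], hence has real part larger than [n]. *)
Lemma centered_deriv_neq0 n q z : (0 < n)%N -> size q = (2 * n).+1 ->
  (forall z, root q z -> modulus z < 1) -> 1 <= modulus z ->
  (centered_deriv n q).[z] != 0.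
Proof.
move=> n0 sq rq z1.
have [s qE] := closed_field_poly_normal q.
have q0 : q != 0 by rewrite -size_poly_gt0 sq.
have lq : lead_coef q != 0 by rewrite lead_coef_eq0.
have ss : size s = (2 * n)%N.
  by move: sq; rewrite qE size_scale // size_prod_XsubC => -[].
have rs r : r \in s -> modulus r < 1.
  by move=> r_s; apply: rq; rewrite qE rootZ // root_prod_XsubC.
have zs r : r \in s -> z != r.
  by move=> /rs r1; apply/eqP => zr; move: z1; rewrite zr leNgt r1.
have qz : q.[z] != 0 by apply/negP => /rq; rewrite ltNge z1.
have dq : q^`().[z] = q.[z] * \sum_(r <- s) (z - r)^-1.
  by rewrite {1}qE derivZ hornerZ deriv_prod_XsubC // mulrA -hornerZ -qE.
have -> : (centered_deriv n q).[z] = q.[z] * (\sum_(r <- s) z / (z - r) - n%:R).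
  by rewrite centered_derivE dq -mulr_sumr; ring.
rewrite mulf_neq0 // subr_eq0; apply/eqP => /(congr1 (@complex.Re R)).
rewrite raddf_sum -(rmorph_nat (real_complex R)) /=; apply/eqP.
have Sn : \sum_(r <- s) (1 / 2 : R) = n%:R.
  rewrite big_const_seq count_predT ss iter_addr_0 mulrnA.
  by congr (_ *+ n); rewrite mulr2n; field.
rewrite gt_eqF // -Sn; case: s {qE zs Sn dq} rs ss => [|r s] rs ss.
  by move: n0; rewrite -(ltn_pmul2l (isT : 0 < 2)%N) -ss.
rewrite !big_cons ltr_leD ?Re_div_sub ?rs ?mem_head //.
rewrite [leLHS]big_seq [leRHS]big_seq.
apply: ler_sum => x xs; rewrite ltW // Re_div_sub // rs //.
by rewrite inE xs orbT.
Qed.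

(** Bernstein's comparison principle.  If the inequality failed at [z], then
    [p - l q] with [l] the quotient of both values would have a
    [centered_deriv] vanishing at [z]; but [l] has modulus larger than 1, so by
    the maximum principle all [2 n] roots of [p - l q] lie in the open disc,
    which excludes this. *)
Lemma centered_deriv_dominated n p q z : (0 < n)%N ->
  (size p <= (2 * n).+1)%N -> size q = (2 * n).+1 ->
  (forall z, root q z -> modulus z < 1) ->
  (forall z, modulus z = 1 -> modulus p.[z] <= modulus q.[z]) ->
  1 <= modulus z ->
  modulus (centered_deriv n p).[z] <= modulus (centered_deriv n q).[z].
Proof.
move=> n0 sp sq rq pq z1.
have Dq := centered_deriv_neq0 n0 sq rq z1.
have qm : q`_(2 * n) != 0.
  by rewrite -[(2 * n)%N]/((2 * n).+1.-1) -sq -/(lead_coef q) lead_coef_eq0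
    -size_poly_gt0 sq.
have sq' : (size q <= (2 * n).+1)%N by rewrite sq.
rewrite leNgt; apply/negP => Dlt.
pose l := (centered_deriv n p).[z] / (centered_deriv n q).[z].
have l1 : 1 < modulus l.
  rewrite modulusM modulusV.
  by rewrite ltr_pdivlMr ?modulus_gt0 // mul1r.
have lne x y : modulus x <= modulus y -> y != 0 -> x - l * y != 0.
  move=> xy y0; rewrite subr_eq0; apply/eqP => E; move: xy.
  rewrite E modulusM leNgt ltr_pMl ?modulus_gt0 //.
  by rewrite l1.
pose F := p - l *: q.
have Fm : F`_(2 * n) != 0.
  by rewrite coefB coefZ lne // max_principle_coef.
have sF : size F = (2 * n).+1.
  apply/eqP; rewrite eqn_leq; apply/andP; split; last first.
    by rewrite ltnNge; apply: contra Fm => /leq_sizeP ->.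
  rewrite (leq_trans (size_polyD _ _)) // geq_max sp size_polyN.
  by rewrite (leq_trans (size_scale_leq _ _)).
have rF w : root F w -> modulus w < 1.
  move=> rw; rewrite ltNge; apply/negP => w1; move: rw.
  rewrite /root hornerD hornerN hornerZ; apply/negP/lne.
    exact: (max_principle_exterior sp sq' qm rq pq).
  by apply/negP => /rq; rewrite ltNge w1.
have /negP := centered_deriv_neq0 n0 sF rF z1; apply.
by rewrite centered_derivB centered_derivZ hornerD hornerN hornerZ divfK // subrr.
Qed.

Lemma cauchy_schwarz2 (a b c d : R) :
  (a * c + b * d) ^+ 2 <= (a ^+ 2 + b ^+ 2) * (c ^+ 2 + d ^+ 2).
Proof. by rewrite -subr_ge0; have := sqr_ge0 (a * d - b * c); nra. Qed.

(** The preceding comparison applied to the combination of [p1] and [p2] that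
    is extremal in the Cauchy-Schwarz inequality at the point [z]. *)
Lemma centered_deriv_dominated2 n p1 p2 q z : (0 < n)%N ->
  (size p1 <= (2 * n).+1)%N -> (size p2 <= (2 * n).+1)%N ->
  size q = (2 * n).+1 ->
  (forall z, root q z -> modulus z < 1) ->
  (forall z, modulus z = 1 ->
     modulus p1.[z] ^+ 2 + modulus p2.[z] ^+ 2 <= modulus q.[z] ^+ 2) ->
  1 <= modulus z ->
  modulus (centered_deriv n p1).[z] ^+ 2 + modulus (centered_deriv n p2).[z] ^+ 2
    <= modulus (centered_deriv n q).[z] ^+ 2.
Proof.
move=> n0 s1 s2 sq rq pq z1.
set u := (centered_deriv n p1).[z]; set v := (centered_deriv n p2).[z].
set E := _ + _; set y := modulus _.
have E0 : 0 <= E by rewrite addr_ge0 // sqr_ge0.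
pose r := Num.sqrt E; have r2 : r ^+ 2 = E by rewrite sqr_sqrtr.
have r0 : 0 <= r by rewrite sqrtr_ge0.
have y0 : 0 <= y by exact: modulus_ge0.
have [->|Ene0] := eqVneq E 0; first exact: sqr_ge0.
have rpos : 0 < r by rewrite lt_neqAle r0 andbT eq_sym sqrtr_eq0 -ltNge lt_neqAle
  eq_sym Ene0.
have rC : r%:C != 0 :> R[i] by rewrite -modulus_gt0 modulusR gtr0_norm.
pose p := u^* *: p1 + v^* *: p2.
have sp : (size p <= (2 * n).+1)%N.
  rewrite (leq_trans (size_polyD _ _)) // geq_max.
  by rewrite !(leq_trans (size_scale_leq _ _)).
have sQ : size (r%:C *: q) = (2 * n).+1 by rewrite size_scale.
have : modulus (centered_deriv n p).[z] <= modulus (centered_deriv n (r%:C *: q)).[z].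
  apply: centered_deriv_dominated => // x; first by rewrite rootZ //; exact: rq.
  move=> x1; rewrite hornerD !hornerZ modulusM modulusR ger0_norm //.
  apply: (le_trans (modulusD _ _)).
  rewrite !modulusM !modulus_conj.
  have := pq _ x1; have := modulus_ge0 q.[x].
  move: (modulus q.[x]) => c c0 hc.
  have := cauchy_schwarz2 (modulus u) (modulus v) (modulus p1.[x]) (modulus p2.[x]).
  move=> cs; rewrite -(@ler_pXn2r _ 2) ?nnegrE //; last 2 first.
  - by rewrite addr_ge0 // mulr_ge0 // modulus_ge0.
  - by rewrite mulr_ge0.
  by rewrite exprMn r2 (le_trans cs) // ler_wpM2l.
have -> : (centered_deriv n p).[z] = E%:C.
  rewrite centered_derivE derivD !derivZ !hornerD !hornerZ.
  rewrite rmorphD /= -!mulc_conj /u /v !centered_derivE; ring.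
rewrite centered_derivZ hornerZ modulusM !modulusR !ger0_norm // -r2 expr2.
by rewrite ler_pM2l // => h; rewrite -expr2 ler_pXn2r // nnegrE.
Qed.

End Comparison.

(** * The Fejer-Riesz factorization *)

Section FejerRiesz.
Variable R : realType.
Implicit Types (p q : {poly R[i]}) (z w r : R[i]).

Lemma eq_poly_circle p q :
  (forall z, modulus z = 1 -> p.[z] = q.[z]) -> p = q.
Proof.
move=> pq; apply/eqP; rewrite -subr_eq0; apply/eqP.
pose N := (size (p - q)).+1; pose rs := [seq zeta R N ^+ k | k <- iota 0 N].
have pz := zeta_prim R (isT : (0 < N)%N).
apply: (@roots_geq_poly_eq0 _ _ rs).
- apply/allP => _ /mapP[k _ ->]; apply/eqP.
  by rewrite hornerD hornerN pq ?zeta_circle // subrr.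
- rewrite map_inj_in_uniq ?iota_uniq // => i j; rewrite !mem_iota /= => iN jN /eqP.
  by rewrite (eq_prim_root_expr pz) !modn_small // => /eqP.
- by rewrite size_map size_iota leqnSn.
Qed.

(** The reciprocal polynomial for the nominal degree [m]; on the circle it
    represents complex conjugation up to the factor [z ^+ m]. *)
Definition conj_rev m p : {poly R[i]} := \poly_(k < m.+1) (p`_(m - k))^*.

Lemma conj_revE m p z : (size p <= m.+1)%N -> z != 0 ->
  (conj_rev m p).[z] = z ^+ m * (p.[(z^-1)^*])^*.
Proof.
move=> sp z0; rewrite horner_poly (horner_coef_wide _ sp) rmorph_sum mulr_sumr /=.
rewrite (reindex_inj rev_ord_inj) /=; apply: eq_bigr => k _.
rewrite rmorphM rmorphXn /= conjcK subSS subKn ?leq_ord // mulrCA.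
by rewrite exprB ?leq_ord ?unitfE // exprVn.
Qed.

Lemma conj_rev_circle m p z : (size p <= m.+1)%N -> modulus z = 1 ->
  (conj_rev m p).[z] = z ^+ m * (p.[z])^*.
Proof.
move=> sp z1; rewrite conj_revE ?circle_neq0 //.
by rewrite -(conjV_circle z1) conjcK.
Qed.

Lemma root_conj_rev m p r : (size p <= m.+1)%N -> r != 0 ->
  root (conj_rev m p) r -> root p (r^-1)^*.
Proof.
move=> sp r0; rewrite /root conj_revE // mulf_eq0 expf_eq0 (negbTE r0) andbF /=.
by rewrite conjc_eq0.
Qed.

Lemma split_roots_disc (W : {poly R[i]}) :
  (forall z, modulus z = 1 -> W.[z] != 0) ->
  exists A B : {poly R[i]}, [/\ W = A * B, A \is monic,
    forall r, root A r -> modulus r < 1 & forall r, root B r -> 1 < modulus r].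
Proof.
move=> Wn0; have W0 : W != 0.
  apply/eqP => W0; have := Wn0 1 (modulus1 R).
  by rewrite W0 horner0 eqxx.
have [s WE] := closed_field_poly_normal W.
have lW : lead_coef W != 0 by rewrite lead_coef_eq0.
pose A := \prod_(r <- s | modulus r < 1) ('X - r%:P).
pose B := lead_coef W *: \prod_(r <- s | ~~ (modulus r < 1)) ('X - r%:P).
have WAB : W = A * B.
  by rewrite {1}WE (bigID (fun r => modulus r < 1)) /= -scalerAr.
exists A, B; split=> // [|r|r Br]; first exact: monic_prod_XsubC.
- by rewrite /A -big_filter root_prod_XsubC mem_filter => /andP[].
- have Wr : W.[r] = 0 by rewrite WAB hornerM (eqP Br) mulr0.
  have r1 : modulus r != 1 by apply/eqP => /Wn0; rewrite Wr eqxx.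
  move: Br; rewrite rootZ // -big_filter root_prod_XsubC mem_filter -leNgt.
  by move=> /andP[r1' _]; rewrite lt_neqAle eq_sym r1.
Qed.

(** The polynomial [W] equals [z ^+ m] times the positive function [g] on the
    circle.  Write [W = A * B] with the roots of [A] inside and those of [B]
    outside.  As [W] is self-reciprocal, the reciprocal [A'] of [A] divides
    [B]; the quotient [E] has its roots outside, and they come in pairs
    symmetric with respect to the circle, so [E] is constant.  Hence
    [g = modulus E * (modulus A) ^+ 2] on the circle, and comparing degrees
    gives [size A = m.+1]. *)
Lemma fejer_riesz m p1 p2 :
  (size p1 <= m.+1)%N -> (size p2 <= m.+1)%N ->
  (forall z, modulus z = 1 -> 0 < modulus p1.[z] ^+ 2 + modulus p2.[z] ^+ 2) ->
  exists q : {poly R[i]}, [/\ size q = m.+1,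
    forall z, root q z -> modulus z < 1 &
    forall z, modulus z = 1 ->
      modulus q.[z] ^+ 2 = modulus p1.[z] ^+ 2 + modulus p2.[z] ^+ 2].
Proof.
move=> s1 s2; set g := fun z => modulus p1.[z] ^+ 2 + modulus p2.[z] ^+ 2.
rewrite -/(forall z, modulus z = 1 -> 0 < g z) => g0.
pose W := p1 * conj_rev m p1 + p2 * conj_rev m p2.
have Wz z : modulus z = 1 -> W.[z] = z ^+ m * (g z)%:C.
  move=> z1; rewrite hornerD !hornerM !conj_rev_circle // rmorphD /=.
  by rewrite -!mulc_conj; ring.
have Wn0 z : modulus z = 1 -> W.[z] != 0.
  move=> z1; rewrite Wz //; apply: mulf_neq0; first by rewrite expf_neq0 ?circle_neq0.
  by rewrite -modulus_eq0 modulusR normr_eq0 gt_eqF // g0.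
have [A [B [WAB mA rA rB]]] := split_roots_disc Wn0.
pose a := (size A).-1.
have sA1 : size A = a.+1 by rewrite prednK // size_poly_gt0 monic_neq0.
have An0 z : modulus z = 1 -> A.[z] != 0.
  by move=> z1; apply/negP => /rA; rewrite z1 ltxx.
pose A' := conj_rev a A.
have A'z z : modulus z = 1 -> A'.[z] = z ^+ a * (A.[z])^*.
  by move=> z1; rewrite conj_rev_circle ?sA1.
have A'0 : A'.[0] = 1.
  rewrite horner_coef0 coef_poly /= subn0.
  by have /monicP := mA; rewrite /lead_coef -/a => ->; rewrite conjc1.
have rA' r : root A' r -> 1 < modulus r.
  move=> A'r; have r0 : r != 0.
    by apply/eqP => r0; move: A'r; rewrite /root r0 A'0 oner_eq0.
  have := root_conj_rev _ r0 A'r; rewrite sA1 leqnn => /(_ isT) /rA.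
  by rewrite modulus_conj modulusV invf_lt1 // modulus_gt0.
have dvdB : A' %| B.
  have cop : coprimep A' ('X^(a + size B) * A).
    apply: Pdiv.ClosedField.root_coprimep => x /rA' x1.
    rewrite hornerM hornerXn mulf_neq0 ?expf_neq0 //.
      by rewrite -modulus_gt0 (lt_trans _ x1).
    by apply/negP => /rA; rewrite ltNge ltW.
  rewrite -(Gauss_dvdpr _ cop) -mulrA -WAB.
  have -> : 'X^(a + size B) * W = 'X^(2 * m) * conj_rev (size B) B * A'.
    apply: eq_poly_circle => z z1.
    rewrite !hornerM !hornerXn A'z // conj_rev_circle ?leqnSn //.
    have -> : W.[z] = z ^+ (2 * m) * (A.[z])^* * (B.[z])^*.
      rewrite -mulrA -conjcM -hornerM -WAB Wz // conjcM conjcXn.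
      rewrite conjc_real conjV_circle // mul2n -addnn exprD mulrA exprVn.
      by rewrite mulfK // expf_neq0 // circle_neq0.
    by rewrite exprD; move: (A.[z]^*) (B.[z]^*) => x y; ring.
  exact: dvdp_mulIr.
have [E BE] := dvdpP _ _ dvdB.
have WE' z : W.[z] = A.[z] * (E.[z] * A'.[z]) by rewrite WAB BE !hornerM.
have Ez z : modulus z = 1 -> z ^+ (2 * a) * E.[z] = z ^+ (2 * m) * (E.[z])^*.
  move=> z1; have z0 := circle_neq0 z1.
  have h : E.[z] = z ^+ m / z ^+ a * (g z / modulus A.[z] ^+ 2)%:C.
    have mAC : (modulus A.[z] ^+ 2)%:C != 0 by rewrite -mulc_conj mulf_eq0 conjc_eq0 orbb An0.
    have za : z ^+ a != 0 by rewrite expf_neq0.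
    apply: (mulfI za); apply: (mulfI mAC).
    have -> : (g z / modulus A.[z] ^+ 2)%:C = (g z)%:C / (modulus A.[z] ^+ 2)%:C.
      exact: fmorph_div.
    transitivity W.[z].
      by rewrite -mulc_conj WE' A'z //; move: A.[z] E.[z] (A.[z]^* ) => x y t; ring.
    rewrite Wz //; move: ((modulus A.[z] ^+ 2)%:C) mAC ((g z)%:C) (z ^+ a) za.
    by move=> d d0 y x x0; field; rewrite d0 x0.
  rewrite h (conjcM (z ^+ m / z ^+ a)) conjc_real.
  have cz k : (z ^+ k)^* = (z ^+ k)^-1 by rewrite conjcXn conjV_circle // exprVn.
  rewrite (conjcM (z ^+ m)) conjc_inv !cz.
  have za : z ^+ a != 0 by rewrite expf_neq0.
  have zm : z ^+ m != 0 by rewrite expf_neq0.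
  rewrite !mul2n -!addnn !exprD; move: (z ^+ a) za (z ^+ m) zm (_%:C).
  by move=> x x0 y y0 d; field; rewrite x0 y0.
have Eroot r : ~~ root E r.
  apply/negP => Er.
  have r1 : 1 < modulus r by apply: rB; rewrite BE rootM Er.
  have r0 : r != 0 by rewrite -modulus_gt0 (lt_trans _ r1).
  have EE : 'X^(size E + 2 * a) * E = 'X^(2 * m) * conj_rev (size E) E.
    apply: eq_poly_circle => z z1.
    rewrite !hornerM !hornerXn conj_rev_circle ?leqnSn // exprD -mulrA Ez //; ring.
  have : root ('X^(2 * m) * conj_rev (size E) E) r by rewrite -EE rootM Er orbT.
  rewrite rootM /root hornerXn expf_eq0 (negbTE r0) andbF /=.
  move=> /(root_conj_rev (leqnSn _) r0) Er'.
  have : 1 < modulus (r^-1)^* by apply: rB; rewrite BE rootM Er'.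
  by rewrite modulus_conj modulusV invf_gt1 ?(lt_trans _ r1) // ltNge ltW.
have /size_poly1P[c c0 Ec] : size E == 1%N.
  by apply/negPn/negP => /closed_rootP[r]; apply/negP.
have am : a = m.
  have : c *: 'X^(2 * a) = c^* *: 'X^(2 * m) :> {poly R[i]}.
    apply: eq_poly_circle => z z1; have := Ez z z1.
    by rewrite Ec !hornerC !hornerZ !hornerXn mulrC => ->; rewrite mulrC.
  move=> /(congr1 (fun p : {poly R[i]} => size p)).
  by rewrite !size_scale ?conjc_eq0 // !size_polyXn => -[] /eqP; rewrite eqn_pmul2l // => /eqP.
have mc : 0 < modulus c by rewrite modulus_gt0.
have sc : (Num.sqrt (modulus c))%:C != 0 :> R[i].
  by rewrite -modulus_gt0 modulusR normr_gt0 gt_eqF // sqrtr_gt0.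
exists ((Num.sqrt (modulus c))%:C *: A); split.
- by rewrite size_scale // sA1 am.
- by move=> z; rewrite rootZ //; exact: rA.
- move=> z z1; rewrite -/(g z) hornerZ modulusM modulusR exprMn.
  rewrite real_normK ?num_real // sqr_sqrtr ?ltW //.
  have := congr1 (@modulus R) (Wz z z1).
  rewrite WE' A'z // Ec hornerC !modulusM modulus_conj !modulusX z1.
  rewrite !expr1n !mul1r modulusR gtr0_norm ?g0 // => <-; ring.
Qed.

End FejerRiesz.

(** * Jensen's formula and the inequality for logarithmic means *)

Section Jensen.
Variable R : realType.
Implicit Types (p q : {poly R[i]}) (z w r : R[i]).

(** Jensen's formula for a polynomial with all roots [r] in the open disc, in
    multiplicative form: the product over the roots of unity is the power of
    the leading coefficient times the product of [modulus (r ^+ N - 1)], which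
    tends to 1. *)
Lemma jensen_zeta q : q != 0 -> (forall z, root q z -> modulus z < 1) ->
  ((\prod_(k < N) modulus q.[zeta R N ^+ k]) / modulus (lead_coef q) ^+ N
    @[N --> \oo] --> (1 : R))%classic.
Proof.
move=> q0 rq; have [s qE] := closed_field_poly_normal q.
have lq : modulus (lead_coef q) != 0 by rewrite modulus_eq0 lead_coef_eq0.
pose t := [seq modulus r | r <- s].
have t1 x : x \in t -> `|x| < 1.
  move=> /mapP[r rs ->]; rewrite ger0_norm ?modulus_ge0 //; apply: rq.
  by rewrite qE rootZ ?lead_coef_eq0 // root_prod_XsubC.
have E N : (0 < N)%N -> \prod_(k < N) modulus q.[zeta R N ^+ k] =
    modulus (lead_coef q) ^+ N * \prod_(r <- s) modulus (r ^+ N - 1).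
  move=> N0; transitivity (\prod_(k < N)
      (modulus (lead_coef q) * \prod_(r <- s) modulus (r - zeta R N ^+ k))).
    apply: eq_bigr => k _; rewrite {1}qE hornerZ modulusM horner_prod modulus_prod.
    by congr (_ * _); apply: eq_bigr => r _; rewrite hornerXsubC modulusBC.
  rewrite big_split prodr_const card_ord exchange_big /=; congr (_ * _).
  by apply: eq_bigr => r _; rewrite -modulus_prod prod_sub_zeta.
apply: (@squeeze_cvgr _ _ _ _ (fun N => \prod_(x <- t) (1 + (-1) * x ^+ N))
  (fun N => \prod_(x <- t) (1 + 1 * x ^+ N))); last 2 first.
- exact: cvg_prod_1Dexp.
- exact: cvg_prod_1Dexp.
exists 1%N => // N /= N0; rewrite E // mulrC mulKf ?expf_neq0 // !big_map.
have tN r : r \in s -> 0 <= modulus r ^+ N <= 1.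
  move=> rs; rewrite exprn_ge0 ?modulus_ge0 //= exprn_ile1 ?modulus_ge0 //.
  have /t1 : modulus r \in t by apply: map_f.
  by rewrite ger0_norm ?modulus_ge0 // => /ltW.
rewrite big_seq [X in _ <= X <= _]big_seq [X in _ <= _ <= X]big_seq.
apply/andP; split; apply: ler_prod => r /tN /andP[r0 r1].
  rewrite mulN1r subr_ge0 r1 /= modulusBC.
  by have := modulusD (1 - r ^+ N) (r ^+ N); rewrite subrK modulus1 modulusX; lra.
rewrite modulus_ge0 mul1r /=.
by have := modulusB (r ^+ N) 1; rewrite modulus1 modulusX; lra.
Qed.

(** Take [q] with the same modulus as the pair [(p1, p2)] on the circle and
    its roots in the open disc.  By Jensen's formula the geometric means of
    [q] and of its centered derivative tend to the moduli of their leading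
    coefficients, whose ratio is [n], and the latter bounds the pair of
    centered derivatives.  The factor 16 only has to be independent of [N]: it
    disappears after taking [N]-th roots. *)
Lemma centered_deriv_mean_zeta n p1 p2 : (0 < n)%N ->
  (size p1 <= (2 * n).+1)%N -> (size p2 <= (2 * n).+1)%N ->
  (forall z, modulus z = 1 -> 0 < modulus p1.[z] ^+ 2 + modulus p2.[z] ^+ 2) ->
  (\forall N \near \oo,
    \prod_(k < N) (modulus (centered_deriv n p1).[zeta R N ^+ k] ^+ 2 +
                   modulus (centered_deriv n p2).[zeta R N ^+ k] ^+ 2) <=
    16 * (n%:R ^+ 2) ^+ N *
      \prod_(k < N) (modulus p1.[zeta R N ^+ k] ^+ 2 +
                     modulus p2.[zeta R N ^+ k] ^+ 2))%classic.
Proof.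
move=> n0 s1 s2 pos; have [q [sq rq qE]] := fejer_riesz s1 s2 pos.
have q0 : q != 0 by rewrite -size_poly_gt0 sq.
have lq : 0 < modulus (lead_coef q) by rewrite modulus_gt0 lead_coef_eq0.
have n0' : 0 < (n%:R : R) by rewrite ltr0n.
pose Dq := centered_deriv n q.
have cDq : Dq`_(2 * n) = n%:R * lead_coef q.
  by rewrite coef_centered_deriv lead_coefE sq /= mul2n -addnn natrD addrK.
have Dqn0 : Dq`_(2 * n) != 0.
  by rewrite cDq mulf_neq0 ?lead_coef_eq0 // pnatr_eq0 -lt0n.
have sDq : size Dq = (2 * n).+1.
  apply/eqP; rewrite eqn_leq size_centered_deriv ?sq //=.
  by rewrite ltnNge; apply: contra Dqn0 => /leq_sizeP ->.
have Dq0 : Dq != 0 by rewrite -size_poly_gt0 sDq.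
have lDq : modulus (lead_coef Dq) = n%:R * modulus (lead_coef q).
  by rewrite lead_coefE sDq /= cDq modulusM modulus_nat.
have rDq z : root Dq z -> modulus z < 1.
  move=> rz; rewrite ltNge; apply/negP => z1.
  by have /negP := centered_deriv_neq0 n0 sq rq z1.
have L1 := jensen_zeta Dq0 rDq; have L2 := jensen_zeta q0 rq.
(* Jensen's ratios are within a factor 2 of 1; 16 is the square of 2 * 2 *)
have := cvgr_le _ L1 (2 : R) ltac:(lra).
have := cvgr_ge _ L2 (1 / 2 : R) ltac:(lra).
apply: filterS2 => N.
rewrite lDq ler_pdivlMr ?exprn_gt0 // ler_pdivrMr ?exprn_gt0 ?mulr_gt0 // => hq hD.
under [X in _ <= _ * X]eq_bigr do rewrite -qE ?zeta_circle //.
apply: (@le_trans _ _ (\prod_(k < N) modulus Dq.[zeta R N ^+ k] ^+ 2)).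
  apply: ler_prod => k _; rewrite addr_ge0 ?sqr_ge0 //=.
  apply: centered_deriv_dominated2 => // [z z1|]; first by rewrite qE.
  by rewrite zeta_circle.
rewrite !prodrXl.
have -> : 16 * (n%:R ^+ 2) ^+ N *
    (\prod_(k < N) modulus q.[zeta R N ^+ k]) ^+ 2 =
    (4 * (n%:R ^+ N * \prod_(k < N) modulus q.[zeta R N ^+ k])) ^+ 2.
  by rewrite exprAC; ring.
have P0 (f : {poly R[i]}) : 0 <= \prod_(k < N) modulus f.[zeta R N ^+ k].
  by apply: prodr_ge0 => k _; exact: modulus_ge0.
rewrite ler_pXn2r ?nnegrE ?mulr_ge0 ?exprn_ge0 ?P0 //.
apply: (le_trans hD); rewrite exprMn.
have := ler_wpM2l (exprn_ge0 N (ltW n0')) hq; lra.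
Qed.

End Jensen.

(** * The averages over shifts that approximate log+ *)

Section LogPlus.
Variable R : realType.
Implicit Types (p q : {poly R[i]}) (z w u : R[i]).

Lemma prod_sub_mul_zeta M (x y : R[i]) : (0 < M)%N ->
  \prod_(l < M) (x - y * zeta R M ^+ l) = x ^+ M - y ^+ M.
Proof.
move=> M0; have [->|y0] := eqVneq y 0.
  under eq_bigr do rewrite mul0r subr0.
  by rewrite prodr_const card_ord expr0n gtn_eqF //= subr0.
under eq_bigr do rewrite -{1}(divfK y0 x) mulrC -mulrBr.
rewrite big_split /= prodr_const card_ord prod_sub_zeta // mulrBr mulr1.
by rewrite -exprMn mulrC divfK.
Qed.

Lemma ler_of_sqr (x y : R) : 0 <= y -> x ^+ 2 <= y ^+ 2 -> x <= y.
Proof.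
move=> y0 xy; have [x0|x0] := ltP x 0; first by rewrite (le_trans (ltW x0)).
by rewrite -(@ler_pXn2r _ 2) ?nnegrE.
Qed.

(** With [s] and [t] the distances from [a] to [-1 - i d] and to [1 - i d],
    [x] and [y] are half the sum and half the difference of [s] and [t]. *)
Lemma joukowski_radii (a d : R) : 0 <= a -> 0 < d -> exists x y : R,
  [/\ x * y = a, x ^+ 2 + y ^+ 2 = a ^+ 2 + 1 + d ^+ 2, 0 <= y, d <= x - y &
      Num.max 1 a <= x <= Num.max 1 a + d].
Proof.
move=> a0 d0.
have [s s0 s2] : exists2 s : R, 0 <= s & s ^+ 2 = (a + 1) ^+ 2 + d ^+ 2.
  exists (Num.sqrt ((a + 1) ^+ 2 + d ^+ 2)); first exact: sqrtr_ge0.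
  by rewrite sqr_sqrtr // addr_ge0 // sqr_ge0.
have [t t0 t2] : exists2 t : R, 0 <= t & t ^+ 2 = (a - 1) ^+ 2 + d ^+ 2.
  exists (Num.sqrt ((a - 1) ^+ 2 + d ^+ 2)); first exact: sqrtr_ge0.
  by rewrite sqr_sqrtr // addr_ge0 // sqr_ge0.
have sa : a + 1 <= s by apply: ler_of_sqr => //; rewrite s2 lerDl sqr_ge0.
have ta : a - 1 <= t by apply: ler_of_sqr => //; rewrite t2 lerDl sqr_ge0.
have ta' : 1 - a <= t.
  by apply: ler_of_sqr => //; rewrite t2 -sqrrN opprB lerDl sqr_ge0.
have td : d <= t by apply: ler_of_sqr => //; rewrite t2 lerDr sqr_ge0.
have ts : t <= s by apply: ler_of_sqr => //; rewrite s2 t2; lra.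
have sa2 : s <= a + 1 + d.
  by apply: ler_of_sqr; rewrite ?s2; nra.
have ta2 : t <= `|a - 1| + d.
  apply: ler_of_sqr; first by rewrite addr_ge0 // ltW.
  rewrite t2 [leRHS]sqrrD real_normK ?num_real // lerD2r lerDl.
  by rewrite mulrn_wge0 // mulr_ge0 // ltW.
exists ((s + t) / 2), ((s - t) / 2); split.
- have -> : (s + t) / 2 * ((s - t) / 2) = (s ^+ 2 - t ^+ 2) / 4 by field.
  by rewrite s2 t2; field.
- have -> : ((s + t) / 2) ^+ 2 + ((s - t) / 2) ^+ 2 = (s ^+ 2 + t ^+ 2) / 2 by field.
  by rewrite s2 t2; field.
- by lra.
- by lra.
have [a1|a1] := leP 1 a; last first.
  by rewrite ler0_norm in ta2; last lra; apply/andP; split; lra.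
by rewrite ger0_norm in ta2; last lra; apply/andP; split; lra.
Qed.

(** By the choice of [x] and [y] each factor is the square of the modulus of
    [x e - y h] with [h] the root of unity and [e] the phase of [u]. *)
Lemma prod_zeta_factor M u (d x y : R) : (0 < M)%N ->
  x * y = modulus u -> x ^+ 2 + y ^+ 2 = modulus u ^+ 2 + 1 + d ^+ 2 ->
  exists e : R[i], modulus e = 1 /\
    \prod_(l < M) (modulus (u - zeta R M ^+ l) ^+ 2 + d ^+ 2) =
    modulus ((x%:C * e) ^+ M - y%:C ^+ M) ^+ 2.
Proof.
move=> M0 xy xy2.
have [e [e1 ue]] : exists e : R[i], modulus e = 1 /\ u = (modulus u)%:C * e.
  have [->|u0] := eqVneq u 0.
    by exists 1; rewrite modulus1 modulus0 mul0r.
  have mu : (modulus u)%:C != 0 by rewrite -modulusE normr_eq0.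
  exists (u / (modulus u)%:C); split; last by rewrite mulrC divfK.
  by rewrite modulusM modulusV modulusR ger0_norm ?modulus_ge0 // divff // modulus_eq0.
exists e; split => //.
rewrite -prod_sub_mul_zeta // modulus_prod -prodrXl.
apply: eq_bigr => l _; move: (zeta_circle R M l) => {M0}; move: (_ ^+ l) => h h1.
have : modulus e ^+ 2 = 1 by rewrite e1 expr1n.
have : modulus h ^+ 2 = 1 by rewrite h1 expr1n.
have -> : d ^+ 2 = x ^+ 2 + y ^+ 2 - 1 - (x * y) ^+ 2 by rewrite xy2 xy; ring.
rewrite ue -xy !modulus_sqr; case: e h {e1 ue h1} => [e1 e2] [h1 h2] /= hh ee.
rewrite !mul0r !subr0 !addr0.
transitivity ((x * y) ^+ 2 * (e1 ^+ 2 + e2 ^+ 2) + (h1 ^+ 2 + h2 ^+ 2)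
   - 2 * (x * y) * (e1 * h1 + e2 * h2) + (x ^+ 2 + y ^+ 2 - 1 - (x * y) ^+ 2)).
  by ring.
transitivity (x ^+ 2 * (e1 ^+ 2 + e2 ^+ 2) + y ^+ 2 * (h1 ^+ 2 + h2 ^+ 2)
   - 2 * (x * y) * (e1 * h1 + e2 * h2)); last by ring.
by rewrite hh ee; ring.
Qed.

(** With [prod_zeta_ge]: up to bounded factors, the product is the [2 M]-th
    power of [Num.max 1 (modulus u)] when [M] is large and [d] is small, that
    is, log+ is a limit of averages of [ln (modulus (u - h) ^+ 2 + d ^+ 2) / 2]
    over roots of unity [h]. *)
Lemma prod_zeta_le M u (d : R) : (0 < M)%N -> 0 < d ->
  \prod_(l < M) (modulus (u - zeta R M ^+ l) ^+ 2 + d ^+ 2) <=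
  (2 * (Num.max 1 (modulus u) + d) ^+ M) ^+ 2.
Proof.
move=> M0 d0.
have [x [y [xy xy2 y0 gap /andP[_ xle]]]] := joukowski_radii (modulus_ge0 u) d0.
have [e [e1 ->]] := prod_zeta_factor M0 xy xy2.
have x0 : 0 <= x by lra.
have m0 : 0 <= Num.max 1 (modulus u) + d by rewrite (le_trans x0).
rewrite ler_pXn2r ?nnegrE ?modulus_ge0 ?mulr_ge0 ?exprn_ge0 //.
apply: (le_trans (modulusB _ _)).
rewrite !modulusX modulusM e1 mulr1 !modulusR !ger0_norm // mulr_natl mulr2n.
by apply: lerD; rewrite lerXn2r ?nnegrE //; lra.
Qed.

(** The ratio of the two radii [y] and [x] is bounded away from 1 uniformly
    for [u] in a bounded set; this is what [d > 0] achieves. *)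
Lemma prod_zeta_ge M u (d K : R) : (0 < M)%N -> 0 < d -> 1 <= K -> modulus u <= K ->
  (Num.max 1 (modulus u) ^+ M * (1 - (K / (K + d)) ^+ M)) ^+ 2 <=
  \prod_(l < M) (modulus (u - zeta R M ^+ l) ^+ 2 + d ^+ 2).
Proof.
move=> M0 d0 K1 uK.
have [x [y [xy xy2 y0 gap /andP[xge xle]]]] := joukowski_radii (modulus_ge0 u) d0.
have [e [e1 ->]] := prod_zeta_factor M0 xy xy2.
have x1 : 1 <= x by apply: le_trans xge; rewrite le_max lexx.
have x0 : 0 < x by lra.
have mK : Num.max 1 (modulus u) <= K by rewrite ge_max K1.
have Kd : 0 < K + d by lra.
have r1 : K / (K + d) <= 1 by rewrite ler_pdivrMr // mul1r; lra.
have r0 : 0 <= K / (K + d) by rewrite divr_ge0 //; lra.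
have m0 : 0 <= Num.max 1 (modulus u) by rewrite le_max ler01.
rewrite ler_pXn2r ?nnegrE ?modulus_ge0 ?mulr_ge0 ?exprn_ge0 ?subr_ge0 ?exprn_ile1 //.
apply: (@le_trans _ _ (x ^+ M - y ^+ M)); last first.
  have := modulusD ((x%:C * e) ^+ M - y%:C ^+ M) (y%:C ^+ M).
  rewrite subrK !modulusX modulusM e1 mulr1 !modulusR !ger0_norm ?(ltW x0) //.
  by rewrite lerBlDr.
have yr : y <= x * (K / (K + d)).
  have xKd : x <= K + d by lra.
  have := ler_pM (ltW x0) (ltW d0) xKd gap.
  by rewrite mulrA ler_pdivlMr //; lra.
have yM : y ^+ M <= x ^+ M * (K / (K + d)) ^+ M.
  by rewrite -exprMn lerXn2r ?nnegrE // mulr_ge0 // ltW.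
have mM : Num.max 1 (modulus u) ^+ M <= x ^+ M by rewrite lerXn2r ?nnegrE // ltW.
have rM : 0 <= 1 - (K / (K + d)) ^+ M by rewrite subr_ge0 exprn_ile1.
have := ler_wpM2r rM mM; lra.
Qed.

End LogPlus.

(** * The inequality for sums over roots of unity *)

Section LogMean.
Variable R : realType.
Implicit Types (p q : {poly R[i]}) (z w u : R[i]).

Lemma horner_circle_bounded p :
  exists K : R, forall z, modulus z = 1 -> modulus p.[z] <= K.
Proof.
exists (\sum_(i < size p) modulus p`_i) => z z1.
rewrite horner_coef (le_trans (modulus_sum _ _ _)) //.
by apply: ler_sum => i _; rewrite modulusM modulusX z1 expr1n mulr1.
Qed.

Lemma ln_prod (I : finType) (F : I -> R) : (forall i, 0 < F i) ->
  ln (\prod_i F i) = \sum_i ln (F i).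
Proof.
move=> F0; suff [] : ln (\prod_i F i) = \sum_i ln (F i) /\ 0 < \prod_i F i by [].
elim/big_rec2: _ => [|i x y _ [<- y0]]; first by rewrite ln1.
by rewrite lnM ?posrE // mulr_gt0.
Qed.

(** Shifting [p] by a multiple of ['X^(2 * n)] shifts [p.[z] / z ^+ (2 * n)]
    by a constant; [centered_deriv_shifted] is the same for the centered
    derivative, because ['X^(2 * n)] is an eigenvector of [centered_deriv n]
    for the eigenvalue [n]. *)
Lemma modulus_shifted n p z c (d : R) : (0 < n)%N -> modulus z = 1 ->
  modulus (p - c *: 'X^(2 * n)).[z] ^+ 2 + modulus (d%:C *: 'X^(2 * n)).[z] ^+ 2 =
  modulus (p.[z] / z ^+ (2 * n) - c) ^+ 2 + d ^+ 2.
Proof.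
move=> n0 z1; have z0 : z ^+ (2 * n) != 0 by rewrite expf_neq0 ?circle_neq0.
rewrite hornerD hornerN !hornerZ !hornerXn modulusM modulusX z1 expr1n mulr1.
rewrite modulusR real_normK ?num_real //; congr (_ ^+ 2 + _).
have -> : p.[z] - c * z ^+ (2 * n) = (p.[z] / z ^+ (2 * n) - c) * z ^+ (2 * n).
  by rewrite mulrBl divfK.
by rewrite modulusM modulusX z1 expr1n mulr1.
Qed.

Lemma centered_derivXn n : centered_deriv n ('X^(2 * n)) = n%:R *: 'X^(2 * n) :> {poly R[i]}.
Proof.
apply/polyP => k; rewrite coef_centered_deriv coefZ coefXn.
case: eqP => [->|_]; last by rewrite !mulr0.
by rewrite mul2n -addnn natrD addrK.
Qed.

Lemma centered_deriv_shifted n p z c (d : R) : (0 < n)%N -> modulus z = 1 ->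
  modulus (centered_deriv n (p - c *: 'X^(2 * n))).[z] ^+ 2 +
  modulus (centered_deriv n (d%:C *: 'X^(2 * n))).[z] ^+ 2 =
  n%:R ^+ 2 *
   (modulus ((centered_deriv n p).[z] / n%:R / z ^+ (2 * n) - c) ^+ 2 + d ^+ 2).
Proof.
move=> n0 z1; have nC : (n%:R : R[i]) != 0 by rewrite pnatr_eq0 -lt0n.
have DB : centered_deriv n (p - c *: 'X^(2 * n)) =
    n%:R *: ((n%:R)^-1 *: centered_deriv n p - c *: 'X^(2 * n)).
  rewrite centered_derivB centered_derivZ centered_derivXn scalerBr.
  by rewrite [_ *: (_ *: centered_deriv _ _)]scalerA divff // scale1r !scalerA [c * _]mulrC.
have DZ : centered_deriv n (d%:C *: 'X^(2 * n)) = n%:R *: (d%:C *: 'X^(2 * n)).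
  by rewrite centered_derivZ centered_derivXn !scalerA [_%:C * _]mulrC.
rewrite DB DZ !(hornerZ n%:R) !modulusM !modulus_nat !exprMn -mulrDr.
by rewrite modulus_shifted // hornerZ [_^-1 * _]mulrC.
Qed.

(** Multiply the inequalities [centered_deriv_mean_zeta] for the pairs made of
    the shift of [p] by [h * 'X^(2 * n)] and of [d * 'X^(2 * n)], for [h] in
    the [M]-th roots of unity, and estimate both sides by [prod_zeta_ge] and
    [prod_zeta_le].  After taking logarithms the errors, per node, are
    [d] and a multiple of [1 / M + 1 / N]. *)
Lemma log_plus_zeta n p (e : R) : (0 < n)%N -> (size p <= (2 * n).+1)%N -> 0 < e ->
  (\forall N \near \oo,
    \sum_(k < N) ln (Num.max 1 (modulus (centered_deriv n p).[zeta R N ^+ k] / n%:R))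
    <= \sum_(k < N) ln (Num.max 1 (modulus p.[zeta R N ^+ k])) + e * N%:R)%classic.
Proof.
move=> n0 sp e0; pose d := e / 3; have d0 : 0 < d by rewrite /d; lra.
have n0' : 0 < (n%:R : R) by rewrite ltr0n.
have [K [K1 hK]] : exists K : R, 1 <= K /\ forall z, modulus z = 1 ->
    modulus (centered_deriv n p).[z] / n%:R <= K.
  have [K hK] := horner_circle_bounded (centered_deriv n p).
  exists (Num.max 1 (K / n%:R)); split; first by rewrite le_max lexx.
  by move=> z z1; rewrite le_max ler_pM2r ?invr_gt0 // hK // orbT.
pose rho := K / (K + d).
have Kd : 0 < K + d by lra.
have r0 : 0 <= rho by rewrite divr_ge0 //; lra.
have r1 : `|rho| < 1 by rewrite ger0_norm // ltr_pdivrMr // mul1r; lra.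
have L2 : 0 < ln (2 : R) by rewrite ln_gt0 // ltr1n.
(* the error is the sum of d and of 2 ln 2 (1 / M + 1 / N): a third of e each *)
have [M [M0 rM eM]] : exists M : nat,
    [/\ (0 < M)%N, rho ^+ M <= 1 / 2 & 6 * ln 2 / e <= M%:R].
  have A1 := cvgr_le _ (cvg_expr r1) (1 / 2 : R) ltac:(lra).
  have A2 := nbhs_infty_ger (6 * ln 2 / e : R).
  have A3 := nbhs_infty_gt 0.
  have [M [? [? ?]]] := filter_ex (filterI A3 (filterI A1 A2)).
  by exists M.
have sX (c : R[i]) : (size (c *: 'X^(2 * n)) <= (2 * n).+1)%N.
  by rewrite (leq_trans (size_scale_leq _ _)) // size_polyXn.
have spX (l : 'I_M) :
    (size (p - zeta R M ^+ l *: 'X^(2 * n))%R <= (2 * n).+1)%N.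
  by rewrite (leq_trans (size_polyD _ _)) // geq_max sp size_polyN sX.
have pos (l : 'I_M) z : modulus z = 1 ->
    0 < modulus (p - zeta R M ^+ l *: 'X^(2 * n)).[z] ^+ 2 +
        modulus (d%:C *: 'X^(2 * n)).[z] ^+ 2.
  by move=> z1; rewrite modulus_shifted // ltr_wpDl ?sqr_ge0 // exprn_gt0.
have H (l : 'I_M) := centered_deriv_mean_zeta n0 (spX l) (sX d%:C) (pos l).
have A2 := nbhs_infty_ger (6 * ln 2 / e : R).
have A3 := nbhs_infty_gt 0.
have FF : Filter (nbhs (\oo : set_system nat))%classic by exact: eventually_filter.
have AH := filter_forall FF H.
apply: (filterS _ (filterI AH (filterI A2 A3))) => N [{}H [eN N0]] {AH A2 A3}.
pose za (k : 'I_N) := zeta R N ^+ k.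
have za1 k : modulus (za k) = 1 by exact: zeta_circle.
pose a k := p.[za k] / za k ^+ (2 * n).
pose b k := (centered_deriv n p).[za k] / n%:R / za k ^+ (2 * n).
pose mu u := Num.max 1 (modulus u).
have mu1 u : 1 <= mu u by rewrite le_max lexx.
have mu0 u : 0 < mu u by rewrite (lt_le_trans _ (mu1 u)).
have div_za x k : modulus (x / za k ^+ (2 * n)) = modulus x.
  by rewrite modulusM modulusV modulusX za1 expr1n invr1 mulr1.
have Eb : \sum_(k < N) ln (Num.max 1 (modulus (centered_deriv n p).[zeta R N ^+ k] / n%:R))
    = \sum_k ln (mu (b k)).
  by apply: eq_bigr => k _; rewrite /mu /b div_za modulusM modulusV modulus_nat.
have Ea : \sum_(k < N) ln (Num.max 1 (modulus p.[zeta R N ^+ k])) = \sum_k ln (mu (a k)).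
  by apply: eq_bigr => k _; rewrite /mu /a div_za.
rewrite Eb Ea.
pose F (u : R[i]) (l : 'I_M) := modulus (u - zeta R M ^+ l) ^+ 2 + d ^+ 2.
have F0 u l : 0 < F u l by rewrite ltr_wpDl ?sqr_ge0 // exprn_gt0.
have main : \prod_k \prod_l F (b k) l <= 16 ^+ M * \prod_k \prod_l F (a k) l.
  rewrite exchange_big [in leRHS]exchange_big /=.
  rewrite -[in 16 ^+ M](card_ord M) -prodr_const -big_split /=.
  apply: ler_prod => l _; rewrite prodr_ge0 => [|k _]; last exact/ltW.
  have nN : 0 < (n%:R ^+ 2) ^+ N :> R by rewrite !exprn_gt0.
  rewrite -(ler_pM2l nN) mulrA [_ * 16]mulrC.
  have := H l; rewrite (eq_bigr (fun k => n%:R ^+ 2 * F (b k) l)); last first.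
    by move=> k _; exact: (centered_deriv_shifted p _ d n0 (za1 k)).
  rewrite big_split prodr_const card_ord /= => /le_trans; apply.
  rewrite le_eqVlt; apply/orP; left; apply/eqP; congr (_ * _).
  by apply: eq_bigr => k _; exact: (modulus_shifted p _ d n0 (za1 k)).
have low : \prod_k ((mu (b k)) ^+ M / 2) ^+ 2 <= \prod_k \prod_l F (b k) l.
  apply: ler_prod => k _; rewrite sqr_ge0 /=.
  have bK : modulus (b k) <= K by rewrite div_za modulusM modulusV modulus_nat hK.
  apply: le_trans (prod_zeta_ge M0 d0 K1 bK).
  have mM : 0 <= mu (b k) ^+ M by rewrite exprn_ge0 // ltW.
  rewrite lerXn2r ?nnegrE ?mulr_ge0 ?subr_ge0 ?exprn_ile1 ?invr_ge0 //.
    by move: r1; rewrite ger0_norm // => /ltW.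
  by rewrite ler_wpM2l // -/rho; lra.
have upp : \prod_k \prod_l F (a k) l <= \prod_k (2 * (mu (a k) * (1 + d)) ^+ M) ^+ 2.
  apply: ler_prod => k _; rewrite prodr_ge0 => [|l _]; last exact/ltW.
  apply: (le_trans (prod_zeta_le _ M0 d0)).
  rewrite -/(mu (a k)).
  have h1 : mu (a k) + d <= mu (a k) * (1 + d).
    by rewrite mulrDr mulr1 lerD2l ler_peMl // ltW.
  have p1 : 0 <= mu (a k) + d by rewrite addr_ge0 // ltW.
  have h2 : (mu (a k) + d) ^+ M <= (mu (a k) * (1 + d)) ^+ M.
    by rewrite lerXn2r ?nnegrE // (le_trans p1).
  have h3 := ler_wpM2l (ler0n R 2) h2.
  have p3 : 0 <= 2 * (mu (a k) + d) ^+ M by rewrite mulr_ge0 // exprn_ge0.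
  by rewrite lerXn2r ?nnegrE // (le_trans p3).
have := le_trans low (le_trans main (ler_wpM2l (exprn_ge0 M (ler0n R 16)) upp)).
have d1 : 0 < 1 + d by lra.
rewrite -ler_ln ?posrE; last 2 first.
- by apply: prodr_gt0 => k _; rewrite exprn_gt0 // divr_gt0 // exprn_gt0.
- rewrite mulr_gt0 ?exprn_gt0 // prodr_gt0 // => k _.
  by rewrite exprn_gt0 // mulr_gt0 // exprn_gt0 // mulr_gt0.
rewrite lnM ?posrE ?exprn_gt0 //; last first.
  by rewrite prodr_gt0 // => k _; rewrite exprn_gt0 // mulr_gt0 // exprn_gt0 // mulr_gt0.
rewrite !ln_prod => [|k|k]; last 2 first.
- by rewrite exprn_gt0 // mulr_gt0 // exprn_gt0 // mulr_gt0.
- by rewrite exprn_gt0 // divr_gt0 // exprn_gt0.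
have -> : \sum_k ln ((mu (b k) ^+ M / 2) ^+ 2) =
    2 * M%:R * \sum_k ln (mu (b k)) - 2 * N%:R * ln 2.
  rewrite mulr_sumr (_ : 2 * N%:R * ln 2 = \sum_(k < N) 2 * ln 2); last first.
    by rewrite sumr_const card_ord -mulr_natl; ring.
  rewrite -sumrB; apply: eq_bigr => k _.
  rewrite lnXn ?divr_gt0 ?exprn_gt0 // lnM ?posrE ?exprn_gt0 ?invr_gt0 //.
  by rewrite lnV ?posrE // lnXn //; ring.
have -> : \sum_k ln ((2 * (mu (a k) * (1 + d)) ^+ M) ^+ 2) =
    2 * M%:R * (\sum_k ln (mu (a k)) + N%:R * ln (1 + d)) + 2 * N%:R * ln 2.
  rewrite (_ : N%:R * ln (1 + d) = \sum_(k < N) ln (1 + d)); last first.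
    by rewrite sumr_const card_ord mulr_natl.
  rewrite (_ : 2 * N%:R * ln 2 = \sum_(k < N) 2 * ln 2); last first.
    by rewrite sumr_const card_ord -mulr_natl; ring.
  rewrite -big_split mulr_sumr -big_split; apply: eq_bigr => k _ /=.
  rewrite lnXn ?mulr_gt0 ?exprn_gt0 ?mulr_gt0 // lnM ?posrE ?exprn_gt0 ?mulr_gt0 //.
  by rewrite lnXn ?mulr_gt0 // lnM ?posrE //; ring.
have -> : ln (16 ^+ M : R) = 4 * M%:R * ln 2.
  have -> : (16 : R) = 2 ^+ 4 by rewrite -natrX.
  by rewrite -exprM lnXn // mulrnA; ring.
have ld : ln (1 + d) <= d by apply: le_ln1Dx; lra.
move: eM eN; rewrite !ler_pdivrMr //.
move: (\sum_k _) (\sum_k _) => sb sa eM eN.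
have M0' : 0 < (M%:R : R) by rewrite ltr0n.
have N0' : 0 < (N%:R : R) by rewrite ltr0n.
move=> h; rewrite -(ler_pM2l M0').
have h1 := ler_wpM2l (ltW N0') eM; have h2 := ler_wpM2l (ltW M0') eN.
have h3 := ler_wpM2l (ltW (mulr_gt0 M0' N0')) ld.
have de : e = 3 * d by rewrite /d; field.
by move: h h1 h2 h3; rewrite de; lra.
Qed.

End LogMean.

(** * Riemann sums of Lipschitz functions *)

Section RiemannSums.
Variable R : realType.
Implicit Types (g : R -> R) (p : {poly R[i]}) (z w : R[i]).
Local Notation mu := (@lebesgue_measure R).

Definition lipschitz_by (L : R) g := forall s t, `|g s - g t| <= L * `|s - t|.

Lemma lipschitz_by_continuous L g : lipschitz_by L g -> continuous g.
Proof.
move=> gL x; apply/cvgrPdist_le => e e0.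
have L0 : 0 <= L.
  by have := gL 1 0; rewrite subr0 normr1 mulr1; apply: le_trans.
near=> y.
apply: (le_trans (gL x y)).
have : `|x - y| <= e / (L + 1).
  near: y; apply: cvgr_dist_le; first exact: cvg_id.
  by rewrite divr_gt0 // ltr_wpDl.
rewrite ler_pdivlMr ?ltr_wpDl //; apply: le_trans.
by rewrite mulrC ler_wpM2l // lerDl.
Unshelve. all: by end_near. Qed.

Lemma lipschitz_by_integrable L g (a b : R) : lipschitz_by L g ->
  mu.-integrable `[a, b]%classic (EFin \o g).
Proof.
move=> gL; apply: continuous_compact_integrable; first exact: segment_compact.
by apply: continuous_subspaceT => x; exact: lipschitz_by_continuous gL x.
Qed.

Lemma riemann_step L g (a h : R) : lipschitz_by L g -> 0 <= a -> 0 <= h ->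
  `|(\int[mu]_(t in `[0, (a + h)]) g t)%R - (\int[mu]_(t in `[0, a]) g t)%R - h * g a|
    <= L * h ^+ 2.
Proof.
move=> gL a0 h0; have ig c d := lipschitz_by_integrable c d gL.
rewrite Rintegral_itvB ?bnd_simp ?lerDl //.
have igo : mu.-integrable `]a, (a + h)] (EFin \o g).
  by apply: integrableS (ig a (a + h)) => //; apply: subset_itvr; rewrite bnd_simp.
rewrite Rintegral_itv_obnd_cbnd //.
have len (c : R) : \int[mu]_(t in `[a, (a + h)]) c = h * c.
  rewrite Rintegral_cst //= lebesgue_measure_itv /= lte_fin.
  case: ltP => hh /=; first by rewrite addrAC subrr add0r mulrC.
  have -> : h = 0 by lra.
  by rewrite mulr0 mul0r.
have icst (c : R) : mu.-integrable `[a, (a + h)] (EFin \o cst c).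
  apply: continuous_compact_integrable; first exact: segment_compact.
  by apply: continuous_subspaceT => x; exact: cvg_cst.
have near_a t : t \in `[a, (a + h)] -> `|g t - g a| <= L * h.
  rewrite in_itv /= => /andP[at1 at2]; apply: (le_trans (gL t a)).
  have L0 : 0 <= L by have := gL 1 0; rewrite subr0 normr1 mulr1; apply: le_trans.
  by rewrite ler_wpM2l // ger0_norm ?subr_ge0 // lerBlDl.
have up : \int[mu]_(t in `[a, (a + h)]) g t <= h * (g a + L * h).
  rewrite -len; apply: le_Rintegral => [|||t /= ht]; [by []|exact: ig|exact: icst|].
  by have /ler_normlP[_] := near_a t ht; lra.
have lo : h * (g a - L * h) <= \int[mu]_(t in `[a, (a + h)]) g t.
  rewrite -len; apply: le_Rintegral => [|||t /= ht]; [by []|exact: icst|exact: ig|].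
  by have /ler_normlP[+ _] := near_a t ht; lra.
clear near_a icst len igo ig; move: up lo; move: (Rintegral _ _ _) (g a) => I c up lo.
by rewrite ler_norml expr2; apply/andP; split; nra.
Qed.

Lemma riemann_sum_error L g (b : R) N : lipschitz_by L g -> 0 <= b -> (0 < N)%N ->
  `|(\int[mu]_(t in `[0, b]) g t)%R - b / N%:R * \sum_(k < N) g (k%:R * (b / N%:R))|
    <= L * b ^+ 2 / N%:R.
Proof.
move=> gL b0 N0; have N0' : 0 < (N%:R : R) by rewrite ltr0n.
set h := b / N%:R; have h0 : 0 <= h by rewrite divr_ge0.
have Nh : N%:R * h = b by rewrite mulrC divfK // gt_eqF.
have -> : L * b ^+ 2 / N%:R = N%:R * (L * h ^+ 2).
  by rewrite /h; field; rewrite gt_eqF.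
rewrite -[X in `[0, X]%classic]Nh.
elim: (N) => [|k IH].
  by rewrite !mul0r set_itv1 Rintegral_set1 big_ord0 mulr0 subrr normr0.
rewrite big_ord_recr /= mulrDr -[k.+1]addn1 natrD !mulrDl !mul1r.
have kh0 : 0 <= k%:R * h by rewrite mulr_ge0.
have := riemann_step gL kh0 h0; move: IH.
move: (Rintegral _ _ _) (Rintegral _ _ _) => I J A B.
apply: le_trans (lerD A B); apply: le_trans (ler_normD _ _).
by rewrite le_eqVlt; apply/orP; left; apply/eqP; congr (Num.norm _); ring.
Qed.

(** The error bound [riemann_sum_error] for both functions is absorbed, for
    large [N], by half of the margin [e], the other half being the allowed
    defect of the sums. *)
Lemma le_Rintegral_of_riemann_sums L L' f g (b : R) :
  lipschitz_by L f -> lipschitz_by L' g -> 0 < b ->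
  (forall e, 0 < e -> \forall N \near \oo,
    \sum_(k < N) f (k%:R * (b / N%:R)) <=
    \sum_(k < N) g (k%:R * (b / N%:R)) + e * N%:R)%classic ->
  \int[mu]_(t in `[0, b]) f t <= \int[mu]_(t in `[0, b]) g t.
Proof.
move=> fL gL b0 H; apply/ler_addgt0Pr => e e0.
have A1 := H (e / (2 * b)) ltac:(by rewrite divr_gt0 // mulr_gt0).
have A2 := nbhs_infty_ger (2 * (L * b ^+ 2 + L' * b ^+ 2) / e : R).
have A3 := nbhs_infty_gt 0.
have [N [N0 [h1 h2]]] := filter_ex (filterI A3 (filterI A1 A2)).
have N0' : 0 < (N%:R : R) by rewrite ltr0n.
have := riemann_sum_error fL (ltW b0) N0; have := riemann_sum_error gL (ltW b0) N0.
move: h2; rewrite ler_pdivrMr // => h2; move: h1.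
set I := \int[mu]_(t in `[0, b]) f t; set J := \int[mu]_(t in `[0, b]) g t.
set s := \sum_(k < N) f _; set t := \sum_(k < N) g _.
clearbody I J s t => h1 /ler_normlP[+ _] /ler_normlP[_]; rewrite opprB => E2 E1.
have h3 : b / N%:R * s <= b / N%:R * t + e / 2.
  have -> : b / N%:R * t + e / 2 = b / N%:R * (t + e / (2 * b) * N%:R).
    by field; rewrite !gt_eqF.
  by rewrite ler_wpM2l // divr_ge0 // ltW.
have h4 : (L * b ^+ 2 + L' * b ^+ 2) / N%:R <= e / 2.
  by rewrite ler_pdivrMr //; lra.
by move: E1 E2 h3 h4; rewrite mulrDl; lra.
Qed.

End RiemannSums.

(** * The integrands *)

Section LogPlusIntegrand.
Variable R : realType.
Implicit Types (p q : {poly R[i]}) (z w : R[i]) (s t : R).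

Lemma cos_lipschitz s t : `|cos s - cos t| <= `|s - t|.
Proof.
wlog st : s t / t <= s.
  move=> H; have [/H//|/ltW/H] := leP t s.
  by rewrite distrC [`|t - s|]distrC.
have [c _ ->] := @MVT_segment R cos (fun x => - sin x) t s st
  (fun x _ => is_derive_cos x) (continuous_subspaceT (@continuous_cos R)).
rewrite normrM ler_piMl // normrN ler_norml sin_le1 andbT; exact: sin_geN1.
Qed.

Lemma sin_lipschitz s t : `|sin s - sin t| <= `|s - t|.
Proof.
wlog st : s t / t <= s.
  move=> H; have [/H//|/ltW/H] := leP t s.
  by rewrite distrC [`|t - s|]distrC.
have [c _ ->] := @MVT_segment R sin cos t s st
  (fun x _ => is_derive_sin x) (continuous_subspaceT (@continuous_sin R)).
rewrite normrM ler_piMl // ler_norml cos_le1 andbT; exact: cos_geN1.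
Qed.

Lemma expi_lipschitz s t :
  modulus ((cos s +i* sin s) - (cos t +i* sin t)) <= 2 * `|s - t|.
Proof.
have c := cos_lipschitz s t; have d := sin_lipschitz s t.
apply: ler_of_sqr; first by rewrite mulr_ge0.
rewrite modulus_sqr /= -(@real_normK _ (cos s - cos t)) ?num_real //.
rewrite -(@real_normK _ (sin s - sin t)) ?num_real //.
have := normr_ge0 (cos s - cos t); have := normr_ge0 (sin s - sin t).
move: c d; move: `|_| `|_| `|_| => x y z; nra.
Qed.

Lemma horner_circle_lipschitz p : exists2 L : R, 0 <= L &
  forall z w, modulus z = 1 -> modulus w = 1 ->
    modulus (p.[z] - p.[w]) <= L * modulus (z - w).
Proof.
elim/poly_ind: p => [|p c [L L0 IH]].
  by exists 0 => // z w _ _; rewrite !horner0 subrr modulus0 mul0r.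
have [K hK] := horner_circle_bounded p.
have K0 : 0 <= K by apply: le_trans (modulus_ge0 _) (hK 1 (modulus1 R)).
exists (L + K) => [|z w z1 w1]; first exact: addr_ge0.
rewrite !hornerMXaddC.
have -> : p.[z] * z + c - (p.[w] * w + c) = (p.[z] - p.[w]) * z + p.[w] * (z - w).
  by ring.
apply: (le_trans (modulusD _ _)); rewrite !modulusM z1 mulr1 mulrDl lerD ?IH //.
by rewrite ler_wpM2r ?modulus_ge0 ?hK.
Qed.

Lemma ln_max1_lipschitz (x y : R) :
  `|ln (Num.max 1 x) - ln (Num.max 1 y)| <= `|x - y|.
Proof.
have ln_le (a b : R) : 1 <= a -> a <= b -> ln b - ln a <= b - a.
  move=> a1 ab; have a0 : 0 < a by apply: lt_le_trans a1.
  have b0 : 0 < b by apply: lt_le_trans ab.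
  rewrite -ln_div ?posrE //; have -> : b / a = 1 + (b - a) / a by field; rewrite gt_eqF.
  have q0 : 0 <= (b - a) / a by rewrite divr_ge0 ?subr_ge0 // ltW.
  rewrite (le_trans (le_ln1Dx _)) //; first exact: lt_le_trans q0.
  by rewrite ler_pdivrMr // ler_peMr // subr_ge0.
wlog xy : x y / y <= x.
  move=> H; have [/H//|/ltW/H] := leP y x.
  by rewrite distrC [`|y - x|]distrC.
have m1 : 1 <= Num.max 1 y by rewrite le_max lexx.
have mxy : Num.max 1 y <= Num.max 1 x by rewrite ge_max !le_max lexx xy orbT.
have mx0 : 0 < Num.max 1 y by apply: lt_le_trans m1.
have lnm : ln (Num.max 1 y) <= ln (Num.max 1 x).
  by rewrite ler_ln ?posrE // (lt_le_trans mx0).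
rewrite !ger0_norm ?subr_ge0 //; apply: (le_trans (ln_le _ _ m1 mxy)).
have [x1|x1] := leP 1 x; have [y1|y1] := leP 1 y; lra.
Qed.

(** The real-valued form, with [ln (Num.max 1 _)] for log+, of the integrand in
    [circle_integral]; this form makes it visibly Lipschitz. *)
Definition log_plus_trace p t : R := ln (Num.max 1 (modulus p.[cos t +i* sin t])).

Lemma log_plus_trace_lipschitz p : exists L, lipschitz_by L (log_plus_trace p).
Proof.
have [L L0 hL] := horner_circle_lipschitz p; exists (L * 2) => s t.
apply: (le_trans (ln_max1_lipschitz _ _)).
have tri (u v : R[i]) : modulus u - modulus v <= modulus (u - v).
  by rewrite lerBlDr -{1}(subrK v u) modulusD.
apply: (@le_trans _ _ (modulus (p.[cos s +i* sin s] - p.[cos t +i* sin t]))).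
  by rewrite ler_norml tri andbT lerNl opprB modulusBC tri.
apply: (le_trans (hL _ _ (expi_circle _) (expi_circle _))).
by rewrite -mulrA ler_wpM2l // expi_lipschitz.
Qed.

(** The value [-oo] of the logarithm at 0 is removed by the maximum with 0. *)
Lemma log_plusE z : log_plus z = (ln (Num.max 1 (modulus z)))%:E.
Proof.
rewrite /log_plus /=; have [z0|z0] := leP (modulus z) 0.
  by rewrite maxNye max_l ?ln1 // (le_trans z0).
rewrite -EFin_max; congr EFin.
have [z1|z1] := leP 1 (modulus z).
  by rewrite max_l // ln_ge0.
by rewrite max_r ?ln1 // -ln1 ler_ln ?posrE // ltW.
Qed.

Lemma circle_integral_log_plus (f : R[i] -> R[i]) p :
  (forall z, modulus z = 1 -> modulus (f z) = modulus p.[z]) ->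
  circle_integral (fun z => log_plus (f z)) =
  (\int[lebesgue_measure]_(t in `[0%R, (2 * pi)%R]) log_plus_trace p t)%:E.
Proof.
move=> fp; have [L gL] := log_plus_trace_lipschitz p.
rewrite /circle_integral /Rintegral fineK; last first.
  by apply: integrable_fin_num; [|exact: lipschitz_by_integrable gL].
by apply: eq_integral => t _; rewrite log_plusE fp // expi_circle.
Qed.

End LogPlusIntegrand.

(** * The derivative of a Laurent polynomial *)

Section Laurent.
Local Open Scope classical_set_scope.

Lemma is_derive_horner (K : numFieldType) (p : {poly K}) (x : K) :
  is_derive x (1 : K) (horner p) p^`().[x].
Proof.
elim/poly_ind: p => [|p c IH].
  rewrite deriv0 horner0 (_ : horner 0 = cst 0); first exact: is_derive_cst.
  by apply/funext => y; rewrite horner0.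
rewrite (_ : horner (p * 'X + c%:P) = (horner p * id) + cst c); last first.
  by apply/funext => y; rewrite hornerMXaddC.
apply: is_derive_eq. rewrite derivMXaddC hornerD hornerM hornerX.
by rewrite addr0 [_%:A]mulr1 [x *: _]mulrC.
Qed.

Lemma derive1_laurent (K : numFieldType) (f : K -> K^o) (p : {poly K}) n (z : K) :
  z != 0 -> (forall w, w != 0 -> f w = p.[w] / w ^+ n) ->
  derive1 f z = (z * p^`().[z] - n%:R * p.[z]) / z ^+ n.+1.
Proof.
move=> z0 fE; rewrite derive1E.
have zn0 : horner 'X^n z != 0 by rewrite hornerXn expf_neq0.
have dh (q : {poly K}) : derivable (horner q) z 1.
  exact: (@ex_derive _ _ _ _ _ _ _ (is_derive_horner q z)).
have Dh (q : {poly K}) : 'D_1 (horner q) z = q^`().[z].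
  exact: (@derive_val _ _ _ _ _ _ _ (is_derive_horner q z)).
rewrite (@near_eq_derive _ _ _ f (horner p * (fun w => (horner 'X^n w)^-1))); last first.
  near=> w; rewrite fE; first by rewrite -[w ^+ n]hornerXn.
  by near: w; apply: cvgr_neq0 z0; exact: cvg_id.
rewrite deriveM //; last exact: derivableV.
rewrite deriveV // !Dh derivXn hornerMn !hornerXn /GRing.scale /=.
case: n zn0 {fE} => [|n] _; first by rewrite !expr0; field.
by rewrite /= !exprS; field; rewrite expf_neq0 z0.
Unshelve. all: by end_near. Qed.

End Laurent.

Unset Implicit Arguments.

Theorem theorem1p2 (R : realType) (n : nat) (T : R[i] -> R[i]) :
  (1 <= n)%N -> trig_poly n T ->
  (circle_integral (fun z => log_plus (cderiv T z / n%:R)%R)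
     <= circle_integral (fun z => log_plus (T z)))%E.
Proof.
move=> n0 [a Ta].
pose p : {poly R[i]} := \poly_(k < (2 * n).+1) a (k%:Z - n%:Z).
have sp : (size p <= (2 * n).+1)%N by exact: size_poly.
have Tp z : z != 0 -> T z = p.[z] / z ^+ n.
  move=> z0; rewrite Ta // horner_poly mulr_suml; apply: eq_bigr => k _.
  by rewrite expfzDr // -exprnN mulrA.
have Tmod z : modulus z = 1 -> modulus (T z) = modulus p.[z].
  move=> z1; rewrite Tp ?circle_neq0 // modulusM modulusV modulusX z1 expr1n.
  by rewrite invr1 mulr1.
have Dmod z : modulus z = 1 -> modulus (cderiv T z / n%:R) =
    modulus (n%:R^-1 *: centered_deriv n p).[z].
  move=> z1; rewrite /cderiv (derive1_laurent (circle_neq0 z1) Tp).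
  rewrite hornerZ centered_derivE [_^-1 * _]mulrC 2!modulusM.
  by rewrite modulusV modulusX z1 expr1n invr1 mulr1 modulusM.
rewrite (circle_integral_log_plus Dmod) (circle_integral_log_plus Tmod) lee_fin.
have [L1 g1] := log_plus_trace_lipschitz (n%:R^-1 *: centered_deriv n p).
have [L2 g2] := log_plus_trace_lipschitz p.
have pi2 : 0 < 2 * pi :> R by rewrite mulr_gt0 // pi_gt0.
apply: (le_Rintegral_of_riemann_sums g1 g2 pi2) => e e0.
apply: filterS (log_plus_zeta n0 sp e0) => N.
rewrite /log_plus_trace; set S1 := \sum_(k < N) _; set S2 := \sum_(k < N) _ => H.
suff [-> ->] : (\sum_(k < N) ln (Num.max 1 (modulus
    (n%:R^-1 *: centered_deriv n p).[cos (k%:R * (2 * pi / N%:R))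
      +i* sin (k%:R * (2 * pi / N%:R))])) = S1 /\
  \sum_(k < N) ln (Num.max 1 (modulus p.[cos (k%:R * (2 * pi / N%:R))
      +i* sin (k%:R * (2 * pi / N%:R))])) = S2) by [].
split; apply: eq_bigr => k _; rewrite -zeta_exp //.
by rewrite hornerZ modulusM modulusV modulus_nat mulrC.
Qed.
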